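(* Let $n\ge 4$ and $2\le k\le n-2$, and let $v,w\in\mathfrak{S}_n$ satisfy $w=v(s_ks_{k+1}\cdots s_{n-1})(s_{k-1}s_{k-2}\cdots s_1)$ and $\ell(w)-\ell(v)=n-1$. Let $1\le i<j\le n$ be such that $\ell(wt_{i,j})=\ell(w)-1$ (equivalently, $w(i)>w(j)$ and $w(p)\notin[w(j),w(i)]$ for every $i<p<j$). Then $wt_{i,j}$ is a coatom of $[v,w]$ if and only if one of the following holds: (1) $1\le i<j\le k$, and $w(p)<w(j)$ for every $i<p<j$; (2) $k<i<j\le n$, and $w(i)<w(p)$ for every $i<p<j$; (3) $1\le i\le k<j\le n$, and $w(p)<w(j)$ for every $i<p\le k$ and $w(i)<w(p)$ for every $k<p<j$. Moreover, $Q_{v,w}$ is combinatorially equivalent to a cube if and only if there is only one pair $(i,j)$ with $\ell(wt_{i,j})=\ell(w)-1$ satisfying (3).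
   Context: $\mathfrak{S}_n$ is the symmetric group on $\{1,\dots,n\}$ with product given by composition $(uz)(k)=u(z(k))$, $t_{i,j}=(i,j)$ is the transposition swapping $i$ and $j$, $s_i=t_{i,i+1}$ are the simple transpositions, $\ell(\cdot)$ is the length with respect to them, and $\le$ is Bruhat order. For $v\le w$, $[v,w]=\{z\in\mathfrak{S}_n\mid v\le z\le w\}$; a coatom of $[v,w]$ is an element of $[v,w]$ covered by $w$. The Bruhat interval polytope $Q_{v,w}$ is the convex hull in $\mathbb{R}^n$ of the points $(z(1),\dots,z(n))$ for $z\in[v,w]$. Two polytopes are combinatorially equivalent if their face posets are isomorphic. *)

(* Defs.v *)
From mathcomp Require Import all_boot all_order all_algebra all_fingroup.
From mathcomp Require Import boolp classical_sets functions reals.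

Set Implicit Arguments.
Unset Strict Implicit.
Unset Printing Implicit Defensive.

Import Order.TTheory GRing.Theory Num.Theory.

Local Open Scope nat_scope.

(* 'S_n permutes {0, ..., n-1}: the element m of {1, ..., n} is represented by
   the ordinal of value m - 1, both as a position and as a value. *)

(* (u \co z) x = u (z x), whereas (u * z)%g x = z (u x) in MathComp. *)
Definition pcomp n (u z : 'S_n) : 'S_n := (z * u)%g.
Notation "u \co z" := (pcomp u z) (at level 40, left associativity).

Lemma pcompE n (u z : 'S_n) x : (u \co z) x = u (z x).
Proof. exact: permM. Qed.

(* x_1 \co x_2 \co ... \co x_l for the sequence [:: x_1; ...; x_l] *)
Definition comp_prod n (s : seq 'S_n) : 'S_n := foldr (@pcomp n) 1%g s.

(* s_m = (m, m+1) for 1 <= m <= n - 1, hence the swap of the ordinals of values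
   m - 1 and m; the identity for all other m. *)
Definition simple_tr n (m : nat) : 'S_n :=
  match insub m.-1, insub m with
  | Some a, Some b => tperm a b
  | _, _ => 1%g
  end.

Definition simples n : {set 'S_n} := [set simple_tr n i.+1 | i : 'I_n.-1].

Lemma simple_tperm n (a b : 'I_n) : b = a.+1 :> nat -> simple_tr n b = tperm a b.
Proof.
move=> eb; rewrite /simple_tr; have -> : (b : nat).-1 = a by rewrite eb.
by rewrite !valK.
Qed.

Lemma tperm_in_simples n (a b : 'I_n) :
  b = a.+1 :> nat -> tperm a b \in simples n.
Proof.
move=> eb; rewrite -(simple_tperm eb) eb.
have lt_a : a < n.-1 by rewrite ltn_predRL -eb.
by apply/imsetP; exists (Ordinal lt_a).
Qed.

Lemma gen_simples n : <<simples n>>%g = [set: 'S_n].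
Proof.
have tp d (a b : 'I_n) : b = d + a.+1 :> nat -> tperm a b \in <<simples n>>%g.
  elim: d b => [|d IHd] b eb; first exact/mem_gen/tperm_in_simples.
  have lt_c : d + a.+1 < n by apply: leq_ltn_trans (ltn_ord b); rewrite eb.
  pose c := Ordinal lt_c.
  have ac : a != c by rewrite -val_eqE /= neq_ltn addnS ltnS leq_addl.
  have ab : a != b by rewrite -val_eqE /= eb neq_ltn addnS ltnS leq_addl.
  have -> : tperm a b = (tperm a c ^ tperm c b)%g.
    by rewrite tpermJ tpermL tpermD // eq_sym.
  by rewrite groupJ ?(IHd c) // mem_gen // tperm_in_simples //= eb.
apply/setP => u; rewrite inE; have [ts -> _] := prod_tpermP u.
apply: group_prod => -[a b] _ /=; have [ab|ab|/val_inj ->] := ltngtP a b.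
- by apply: (tp (b - a.+1)); rewrite subnK.
- by rewrite tpermC; apply: (tp (a - b.+1)); rewrite subnK.
- by rewrite tperm1 group1.
Qed.

Definition has_word n (u : 'S_n) (l : nat) : bool :=
  [exists t : l.-tuple 'S_n, all (mem (simples n)) t && (comp_prod t == u)].

Lemma ex_word n (u : 'S_n) : exists l, has_word u l.
Proof.
have : (u^-1)%g \in <<simples n>>%g by rewrite gen_simples inE.
case/gen_prodgP => l [c cS] eu; exists l; apply/existsP.
have invS x : x \in simples n -> (x^-1)%g = x.
  case/imsetP => i _ ->; rewrite /simple_tr.
  by case: insub => [a|]; [case: insub => [b|]|]; rewrite ?invg1 ?tpermV.
exists [tuple c i | i < l]; apply/andP; split.
  by apply/allP => x /mapP[i _ ->]; exact: cS.
rewrite -[u]invgK eu /=.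
have -> : enum 'I_l = index_enum 'I_l by rewrite [index_enum _]unlock enumT.
elim: (index_enum _) => [|i e IHe] /=; first by rewrite big_nil invg1.
by rewrite big_cons invMg (eqP IHe) (invS _ (cS i)).
Qed.

(* length with respect to the simple transpositions *)
Definition ell n (u : 'S_n) : nat := ex_minn (ex_word u).

(* Bruhat order: reflexive transitive closure of u -> u t_{a,b} whenever this
   increases the length. *)
Definition bruhat_step n : rel 'S_n := fun u z =>
  [exists a : 'I_n, exists b : 'I_n, (z == u \co tperm a b) && (ell u < ell z)].

Definition bruhat_le n : rel 'S_n := connect (@bruhat_step n).

Definition bruhat_lt n : rel 'S_n := fun u z => (u != z) && bruhat_le u z.

Definition bruhat_covers n (w z : 'S_n) : bool :=
  bruhat_lt z w && [forall y, ~~ (bruhat_lt z y && bruhat_lt y w)].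

Definition bruhat_interval n (v w : 'S_n) : {set 'S_n} :=
  [set z | bruhat_le v z && bruhat_le z w].

Definition coatom n (v w z : 'S_n) : bool :=
  (z \in bruhat_interval v w) && bruhat_covers w z.

Section Polytopes.
Local Open Scope ring_scope.
Local Open Scope classical_set_scope.
Variable R : realType.

Definition conv_hull n (I : finType) (A : {set I}) (pt : I -> 'rV[R]_n) :
  set 'rV[R]_n :=
  [set x | exists c : I -> R,
    [/\ forall i, i \in A -> 0 <= c i,
        \sum_(i in A) c i = 1 &
        x = \sum_(i in A) c i *: pt i]].

(* the point (z(1), ..., z(n)), with values in {1, ..., n} *)
Definition perm_point n (z : 'S_n) : 'rV[R]_n := \row_i (z i).+1%:R.

Definition bruhat_interval_polytope n (v w : 'S_n) : set 'rV[R]_n :=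
  conv_hull (bruhat_interval v w) (@perm_point n).

(* F is cut out of P by a valid linear inequality; set0 and P itself are
   always faces. *)
Definition is_face n (P F : set 'rV[R]_n) : Prop :=
  exists (c : 'rV[R]_n) (b : R),
    (forall x, P x -> \sum_i c 0 i * x 0 i <= b) /\
    F = [set x | P x /\ \sum_i c 0 i * x 0 i = b].

Definition faces n (P : set 'rV[R]_n) : set (set 'rV[R]_n) :=
  [set F | is_face P F].

Definition comb_equiv m n (P : set 'rV[R]_m) (Q : set 'rV[R]_n) : Prop :=
  exists f : set 'rV[R]_m -> set 'rV[R]_n,
    set_bij (faces P) (faces Q) f /\
    forall F G, faces P F -> faces P G -> (F `<=` G <-> f F `<=` f G).

Definition cube d : set 'rV[R]_d := [set x | forall i, 0 <= x 0 i <= 1].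

Definition comb_cube n (P : set 'rV[R]_n) : Prop :=
  exists d : nat, comb_equiv P (@cube d).

End Polytopes.

Arguments perm_point R {n} z.
Arguments bruhat_interval_polytope R {n} v w.
Arguments cube R d : clear implicits.

(* Main.v *)
Require Import Defs.
From mathcomp Require Import all_boot all_order all_algebra all_fingroup.
From mathcomp Require Import boolp classical_sets functions reals.
From mathcomp Require Import zify ring lra.

(* In one-line notation [v] = x_2 .. x_k b a y_(k+1) .. y_(n-1) and
   [w] = a x_2 .. x_k y_(k+1) .. y_(n-1) b with x_i < a, b < y_i and b < a.  The
   sets of the first m values of [v] and [w] differ by one exchange, so the rank
   criterion for Bruhat order leaves for the rank function of an element of
   [v, w] at most two values at each place; this gives (1)-(3).

   For 1 < j <= k there is exactly one pair (i, j) as in (1), and for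
   k < i < n exactly one pair (i, j) as in (2), n - 2 in all.  All coatoms give
   edges of the polytope at [w], in directions e_j - e_i.  In a cube the edges at
   a vertex are linearly independent, and there are at most n - 1 independent
   vectors of coordinate sum 0, so a cube has at most one pair as in (3).

   Conversely, let p <= k be the last position with w(p) > b and q > k the first
   one with w(q) < a.  If the pair (3) is unique, then w(q) < w(p) and it is
   (p, q).  Then, in the coordinates X_m = x_1 + .. + x_m, the polytope is cut out
   by inequalities g_m <= X_m <= h_m (0 < m < n), in which g_m and h_m are affine
   functions of the preceding coordinates for a suitable order (that of a Bott
   tower); every element of [v, w] satisfies exactly one of them with equality
   for each m, and all the 2^(n-1) choices occur.  Such a polytope is a
   combinatorial cube. *)

Set Implicit Arguments.
Unset Strict Implicit.
Unset Printing Implicit Defensive.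

Import Order.TTheory GRing.Theory Num.Theory.

Local Open Scope nat_scope.

(** * Inversions and length *)

(** Rank functions carry the argument because prefix sums are sums of ranks: with 1-based values,
    X_m of a permutation z is the sum of [rk z m t] over all thresholds t. An inequality between
    prefix sums at the vertices thus follows from the same inequality between ranks at each single
    threshold, where v and w differ by at most one. The bound g_m compares the excess of z over v at
    m with the excesses at earlier places, h_m compares deficits from w; only m = k needs two
    earlier places. Uniqueness of the pair (3) enters through w(q) < w(p) alone, which ensures that
    these two excesses are never positive at the same threshold. No map onto a cube is built from
    geometry: the polytope and the cube satisfy the same four axioms ([cube_data]), and these
    determine the face poset. In the other direction neither the dimension of the polytope nor that
    of the cube is computed, since n independent vectors of coordinate sum 0 in n-space are already
    contradictory. *)

Section OneLine.
Variable n : nat.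
Implicit Types (u z : 'S_n) (i j : 'I_n).

(* The junk value outside [0, n) is 0. *)
Definition pv z (p : nat) : nat := oapp (fun i => nat_of_ord (z i)) 0 (insub p).

Lemma pvE z i : pv z i = z i.
Proof. by rewrite /pv valK. Qed.

Lemma pv_lt z p : p < n -> pv z p < n.
Proof. by move=> lt_p; rewrite -[p]/(nat_of_ord (Ordinal lt_p)) pvE. Qed.

Lemma pv_inj z p q : p < n -> q < n -> pv z p = pv z q -> p = q.
Proof.
move=> lt_p lt_q.
rewrite -[p]/(nat_of_ord (Ordinal lt_p)) -[q]/(nat_of_ord (Ordinal lt_q)) !pvE.
by move/val_inj/perm_inj=> ->.
Qed.

Lemma eq_pv u z : (forall p, p < n -> pv u p = pv z p) -> u = z.
Proof. by move=> uz; apply/permP=> i; apply: val_inj; rewrite /= -!pvE uz. Qed.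

Lemma pv_tperm z i j p : pv (z \co tperm i j) p =
  if p == i then pv z j else if p == j then pv z i else pv z p.
Proof.
have [lt_p|ge_p] := ltnP p n; last first.
  by rewrite !gtn_eqF ?(leq_trans (ltn_ord _)) // /pv insubN // -leqNgt.
rewrite -[p]/(nat_of_ord (Ordinal lt_p)) !pvE pcompE permE /= -!val_eqE /=.
by case: eqP => // _; case: eqP.
Qed.

Lemma pcompA (x y z : 'S_n) : x \co (y \co z) = x \co y \co z.
Proof. by rewrite /Defs.pcomp mulgA. Qed.

Lemma pcomp1 (x : 'S_n) : x \co 1%g = x.
Proof. by rewrite /Defs.pcomp mul1g. Qed.

Lemma pcompKt z i j : z \co tperm i j \co tperm i j = z.
Proof. by rewrite -pcompA [_ \co tperm i j]/Defs.pcomp tperm2 pcomp1. Qed.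

Definition ninv u : nat := \sum_(a < n) \sum_(b < n) ((a < b) && (u b < u a)).

Lemma sum2_split (F : 'I_n -> 'I_n -> nat) i j : i != j ->
  \sum_a \sum_b F a b =
  F i i + F i j + F j i + F j j +
  \sum_(p | (p != i) && (p != j)) (F i p + F j p + F p i + F p j) +
  \sum_(p | (p != i) && (p != j)) \sum_(r | (r != i) && (r != j)) F p r.
Proof.
move=> ij; have ji : j != i by rewrite eq_sym.
have S (f : 'I_n -> nat) :
    \sum_b f b = f i + f j + \sum_(r | (r != i) && (r != j)) f r.
  by rewrite (bigD1 i) //= (bigD1 j) //= addnA.
rewrite S !(S (F _)) (eq_bigr _ (fun p _ => S (F p))) !big_split /=.
lia.
Qed.

(** Besides the pair (i, j), only a position p between i and j with value between u(j) and u(i)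
    matters: it loses its inversions with both i and j. For any other p the pairs with i and with j
    contribute the same total before and after. *)
Lemma inv_tperm u i j : i < j -> u j < u i ->
  ninv u = ninv (u \co tperm i j) +
          (\sum_(p < n) [&& i < p, p < j, u j < u p & u p < u i]).*2.+1.
Proof.
move=> ij uij; have nij : i != j by rewrite -val_eqE neq_ltn ij.
(* Reindexing both sums by the transposition leaves the values alone and permutes the positions
   instead. *)
have -> : ninv (u \co tperm i j) =
    \sum_a \sum_b ((tperm i j a < tperm i j b) && (u b < u a)).
  rewrite /ninv (reindex_inj (@perm_inj _ (tperm i j))) /=.
  apply: eq_bigr => a _; rewrite (reindex_inj (@perm_inj _ (tperm i j))) /=.
  by apply: eq_bigr => b _; rewrite !pcompE !tpermK.
rewrite /ninv !(sum2_split _ nij) tpermL tpermR.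
have -> : \sum_(p < n) [&& i < p, p < j, u j < u p & u p < u i] =
    \sum_(p | (p != i) && (p != j)) [&& i < p, p < j, u j < u p & u p < u i].
  rewrite (bigID (fun p => (p != i) && (p != j))) /= [X in _ + X]big1 ?addn0 //.
  move=> p; rewrite negb_and !negbK => /orP[] /eqP->; first by rewrite ltnn.
  by rewrite ltnn andbF.
have -> : \sum_(p | (p != i) && (p != j)) \sum_(r | (r != i) && (r != j))
    ((tperm i j p < tperm i j r) && (u r < u p) : nat) =
  \sum_(p | (p != i) && (p != j)) \sum_(r | (r != i) && (r != j))
    ((p < r) && (u r < u p) : nat).
  apply: eq_bigr => p /andP[pi pj]; apply: eq_bigr => r /andP[ri rj].
  by rewrite !tpermD // eq_sym.
set A := \sum_(p | _) \sum_(r | _) _.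
have -> : \sum_(p | (p != i) && (p != j))
     (((i < p) && (u p < u i)) + ((j < p) && (u p < u j)) +
      ((p < i) && (u i < u p)) + ((p < j) && (u j < u p))) =
  \sum_(p | (p != i) && (p != j))
     (((j < tperm i j p) && (u p < u i)) + ((i < tperm i j p) && (u p < u j)) +
      ((tperm i j p < j) && (u i < u p)) + ((tperm i j p < i) && (u j < u p))) +
  (\sum_(p | (p != i) && (p != j)) [&& i < p, p < j, u j < u p & u p < u i]).*2.
  rewrite -muln2 big_distrl -big_split /=.
  apply: eq_bigr => p /andP[pi pj]; rewrite tpermD 1?eq_sym //.
  have nupi : u p != u i :> nat by rewrite val_eqE (inj_eq perm_inj).
  have nupj : u p != u j :> nat by rewrite val_eqE (inj_eq perm_inj).
  move: pi pj; rewrite -!val_eqE /= => pi pj.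
  by case: (ltngtP i p) (ltngtP j p) (ltngtP (u p) (u i)) (ltngtP (u p) (u j));
    lia.
rewrite !ltnn; lia.
Qed.

End OneLine.

(** * Length equals the number of inversions *)

Section Length.
Variable n : nat.
Implicit Types (u z : 'S_n) (i j : 'I_n) (s : seq 'S_n).

Lemma comp_prod_rcons s z : comp_prod (rcons s z) = comp_prod s \co z.
Proof.
elim: s => [|x s IHs] /=; first by rewrite /Defs.pcomp mul1g mulg1.
by rewrite IHs pcompA.
Qed.

Lemma mem_simplesP z :
  z \in simples n -> exists i j, j = i.+1 :> nat /\ z = tperm i j.
Proof.
case/imsetP=> -[m ltm] _ ->; have lt1 : m.+1 < n by rewrite -ltn_predRL.
exists (Ordinal (ltnW lt1)), (Ordinal lt1); split=> //.
exact: (@simple_tperm n (Ordinal (ltnW lt1)) (Ordinal lt1)).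
Qed.

Lemma inv_tperm_adj_gt u i j : j = i.+1 :> nat -> u j < u i ->
  ninv u = (ninv (u \co tperm i j)).+1.
Proof.
move=> ji uij; rewrite (inv_tperm _ uij) ?ji // big1 ?addn1 // => p _.
by case: ltngtP => // ip; rewrite ltnNge ip.
Qed.

Lemma inv_tperm_adj_lt u i j : j = i.+1 :> nat -> u i < u j ->
  ninv (u \co tperm i j) = (ninv u).+1.
Proof.
move=> ji uij; rewrite -[u in RHS](pcompKt u i j); apply: inv_tperm_adj_gt => //.
by rewrite !pcompE tpermL tpermR.
Qed.

Lemma inv_tperm_adj_le u i j : j = i.+1 :> nat ->
  ninv (u \co tperm i j) <= (ninv u).+1.
Proof.
move=> ji; case: (ltngtP (u i) (u j)) => [uij|uij|/val_inj/perm_inj ij].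
- by rewrite (inv_tperm_adj_lt ji uij).
- by rewrite (inv_tperm_adj_gt ji uij) leqW.
by move: ji; rewrite -ij => /n_Sn.
Qed.

Lemma inv_comp_prod s : all (mem (simples n)) s -> ninv (comp_prod s) <= size s.
Proof.
elim/last_ind: s => [_|s x IHs] /=.
  rewrite /ninv big1 // => a _; rewrite big1 // => b _.
  by rewrite !perm1; case: ltngtP.
rewrite all_rcons => /andP[/mem_simplesP[i [j [ji ->]]] /IHs le_s].
rewrite comp_prod_rcons size_rcons.
exact: leq_trans (inv_tperm_adj_le _ ji) _.
Qed.

(** Ascents squeeze u(p): counting up from position 0 gives p <= u(p), counting down from n - 1
    gives the converse. *)
Lemma no_descent_id u :
  (forall i j, j = i.+1 :> nat -> u i < u j) -> u = 1%g.
Proof.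
move=> asc; apply: eq_pv => p lt_p.
have ge_id q : q < n -> q <= pv u q.
  elim: q => // q IHq lt_q; apply: leq_ltn_trans (IHq (ltnW lt_q)) _.
  have := asc (Ordinal (ltnW lt_q)) (Ordinal lt_q) erefl.
  by rewrite -!pvE.
have le_id d : forall q, q + d < n -> pv u q + d < n.
  elim: d => [|d IHd] q lt_q; first by move: lt_q; rewrite !addn0; exact: pv_lt.
  have lt_q1 : q.+1 < n by lia.
  have := asc (Ordinal (ltnW lt_q1)) (Ordinal lt_q1) erefl.
  rewrite -!pvE /= => lt_uq; have := IHd q.+1; lia.
transitivity p; last first.
  by rewrite -[p in RHS]/(nat_of_ord (Ordinal lt_p)) pvE perm1.
have := ge_id p lt_p; have := le_id (n - p.+1) p; lia.
Qed.

(** Bubble sort: a permutation other than the identity has an adjacent descent, and undoing it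
    removes exactly one inversion. *)
Lemma has_word_inv u : has_word u (ninv u).
Proof.
have noD0 z : (forall i j, j = i.+1 :> nat -> z i < z j) -> ninv z = 0.
  move/no_descent_id->; rewrite /ninv big1 // => a _; rewrite big1 // => b _.
  by rewrite !perm1; case: ltngtP.
have descP z : (forall i j, j = i.+1 :> nat -> z i < z j) \/
    exists i j, j = i.+1 :> nat /\ z j < z i.
  have [/existsP[i /existsP[j /andP[/eqP ji zij]]]|noD] :=
    boolP [exists i : 'I_n, exists j : 'I_n, (j == i.+1 :> nat) && (z j < z i)].
    by right; exists i, j.
  left=> i j ji; rewrite ltnNge leq_eqVlt; apply/negP.
  case/orP=> [/eqP/val_inj/perm_inj ij|zij].
    by move: ji; rewrite ij => /n_Sn.
  by case/existsP: noD; exists i; apply/existsP; exists j; rewrite ji eqxx.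
move: {2}(ninv u) (erefl (ninv u)) => l.
elim: l u => [|l IHl] u eq_l; rewrite eq_l.
  have [/no_descent_id->|[i [j [ji uij]]]] := descP u; last first.
    by have := inv_tperm_adj_gt ji uij; rewrite eq_l.
  by apply/existsP; exists [tuple]; apply/eqP.
have [/noD0|[i [j [ji uij]]]] := descP u; first by rewrite eq_l.
have := inv_tperm_adj_gt ji uij; rewrite eq_l => -[eq_l']; have := IHl _ (esym eq_l').
rewrite -eq_l' => /existsP[t /andP[all_t /eqP def_u]]; apply/existsP.
exists [tuple of rcons t (tperm i j)] => /=.
rewrite all_rcons all_t comp_prod_rcons def_u pcompKt eqxx !andbT.
exact: tperm_in_simples.
Qed.

Lemma ellE u : ell u = ninv u.
Proof.
rewrite /ell; case: ex_minnP => l /existsP[t /andP[all_t /eqP def_u]] min_l.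
apply/eqP; rewrite eqn_leq min_l ?has_word_inv //=.
by rewrite -def_u -[leqRHS](size_tuple t) inv_comp_prod.
Qed.

Lemma ell_tperm_lt u i j : i < j -> (ell (u \co tperm i j) < ell u) = (u j < u i).
Proof.
move=> ij; rewrite !ellE; case: (ltngtP (u i) (u j)) => [uij|uij|/val_inj/perm_inj].
- have := @inv_tperm n (u \co tperm i j) i j ij.
  rewrite !pcompE tpermL tpermR pcompKt => /(_ uij) ->.
  by apply/negbTE; rewrite -leqNgt; lia.
- by rewrite (inv_tperm ij uij); lia.
by move=> eij; rewrite eij ltnn in ij.
Qed.

(** The drop in length is one plus twice the number of intermediate entries counted in
    [inv_tperm]. *)
Lemma ell_tperm_coverP u i j : i < j ->
  (ell (u \co tperm i j)).+1 = ell u <->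
  u j < u i /\ forall p : 'I_n, i < p -> p < j -> ~ (u j <= u p /\ u p <= u i).
Proof.
move=> ij; split.
  move=> eq1; have uij : u j < u i by rewrite -(ell_tperm_lt _ ij) -eq1.
  split=> // p ip pj [ujp upi].
  have := inv_tperm ij uij; rewrite -!ellE (bigD1 p) //= -eq1.
  have -> : u j < u p.
    rewrite ltn_neqAle ujp andbT; apply: contraTneq pj => /val_inj/perm_inj ->.
    by rewrite ltnn.
  have -> : u p < u i.
    rewrite ltn_neqAle upi andbT; apply: contraTneq ip => /val_inj/perm_inj ->.
    by rewrite ltnn.
  by rewrite ip pj; lia.
case=> uij noP; rewrite !ellE (inv_tperm ij uij) big1 ?addn1 // => p _.
case: andP => // -[ip /and3P[pj ujp upi]].
by case: (noP p ip pj); split; exact: ltnW.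
Qed.

End Length.

(** * Bruhat order and rank functions *)

Section Rank.
Variable n : nat.
Implicit Types (u z v w : 'S_n) (i j : 'I_n).

Definition rk z (m q : nat) : nat := \sum_(p < m) (q <= pv z p).

Lemma rk0 z q : rk z 0 q = 0.
Proof. by rewrite /rk big_ord0. Qed.

Lemma rkS z m q : rk z m.+1 q = rk z m q + (q <= pv z m).
Proof. by rewrite /rk big_ord_recr. Qed.

(** Both counts grow equally over the positions [s, t), as no entry there lies in [q, q'). Here and
    below, negative terms are moved to the other side, since subtraction of naturals truncates. *)
Lemma rk_window z s t q q' : s <= t -> q <= q' ->
  (forall p, s <= p < t -> q <= pv z p -> q' <= pv z p) ->
  rk z t q + rk z s q' = rk z t q' + rk z s q.
Proof.
move=> st qq'; rewrite -(subnKC st).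
elim: (t - s) => [|d IHd] win; first by rewrite addn0 addnC.
have IH : rk z (s + d) q + rk z s q' = rk z (s + d) q' + rk z s q.
  by apply: IHd => p sp; apply: win; lia.
by rewrite addnS !rkS; have := win (s + d); lia.
Qed.

Lemma rk_low z s t q : s <= t ->
  (forall p, s <= p < t -> pv z p < q) -> rk z t q = rk z s q.
Proof.
move=> st; rewrite -(subnKC st).
elim: (t - s) => [|d IHd] win; first by rewrite addn0.
rewrite addnS rkS IHd => [|p sp]; last by apply: win; lia.
by have := win (s + d); lia.
Qed.

Lemma rk_high z s t q : s <= t ->
  (forall p, s <= p < t -> q <= pv z p) -> rk z t q = rk z s q + (t - s).
Proof.
move=> st; rewrite -{1 2}(subnKC st).
elim: (t - s) => [|d IHd] win; first by rewrite !addn0.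
rewrite addnS rkS IHd => [|p sp]; last by apply: win; lia.
by have := win (s + d); lia.
Qed.

Lemma rk_mono z s t q : s <= t -> rk z s q <= rk z t q <= rk z s q + (t - s).
Proof.
move=> st; rewrite -{1 2}(subnKC st).
elim: (t - s) => [|d IHd]; first by rewrite !addn0 !leqnn.
by rewrite addnS rkS; lia.
Qed.

Lemma rk_mono2 z s t q q' : s <= t -> q <= q' ->
  rk z t q' + rk z s q <= rk z t q + rk z s q'.
Proof.
move=> st qq'; rewrite -(subnKC st).
elim: (t - s) => [|d IHd]; first by rewrite addn0 addnC.
by rewrite addnS !rkS; lia.
Qed.

Lemma rk_tperm z i j m q :
  rk (z \co tperm i j) m q +
    ((i < m) && (q <= pv z i)) + ((j < m) && (q <= pv z j)) =
  rk z m q + ((j < m) && (q <= pv z i)) + ((i < m) && (q <= pv z j)).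
Proof.
elim: m => [|m IHm]; first by rewrite !rk0 !ltn0.
rewrite !rkS pv_tperm; case: (eqVneq m i) IHm => [->|mi] IHm.
  by case: (ltngtP i j) IHm => [||<-]; lia.
by case: (eqVneq m j) IHm mi => [->|mj] IHm mi; lia.
Qed.

(** The tableau criterion: counts above all thresholds encode the sorted prefixes of a
    permutation. *)
Definition ble u z := forall m q, rk u m q <= rk z m q.

Lemma ble_trans u v w : ble u v -> ble v w -> ble u w.
Proof. by move=> uv vw m q; exact: leq_trans (uv m q) (vw m q). Qed.

Lemma pcompC_tperm z i j : z \co tperm i j = z \co tperm j i.
Proof. by rewrite tpermC. Qed.

Lemma bruhat_le_ble u z : bruhat_le u z -> ble u z.
Proof.
case/connectP=> s; elim: s u => [|x s IHs] u /=; first by move=> _ -> m q.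
case/andP=> /existsP[a /existsP[b /andP[/eqP def_x lt_ux]]] path_s def_z.
apply: ble_trans (IHs _ path_s def_z) => m q.
wlog ab : a b def_x / a < b.
  move=> wlog_ab; case: (ltngtP a b) => [|ba|/val_inj ab].
  - exact: wlog_ab.
  - by apply: (wlog_ab b a) => //; rewrite pcompC_tperm.
  by rewrite def_x ab tperm1 pcomp1 ltnn in lt_ux.
have uab : u a < u b.
  rewrite ltnNge leq_eqVlt negb_or -leqNgt; apply/andP; split.
    by apply: contraTneq ab => /val_inj/perm_inj->; rewrite ltnn.
  by rewrite leqNgt -(ell_tperm_lt _ ab) -leqNgt -def_x ltnW.
have := rk_tperm u a b m q; rewrite -def_x !pvE; lia.
Qed.

(* Ehresmann's argument: raise [u] at the first position [i] where it differs
   from [z], exchanging with the first later value in [(u i, z i]]. *)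
Lemma ble_step u z : ble u z -> u <> z ->
  exists i j, [/\ i < j, u i < u j & ble (u \co tperm i j) z].
Proof.
move=> uz neq.
have [i neq_i min_i] : exists2 i, u i != z i & forall p : 'I_n, p < i -> u p = z p.
  have [i0 neq0] : exists i, u i != z i.
    by apply/existsP; rewrite -negb_forall; apply/negP => /forallP eq_uz;
       apply: neq; apply/permP => i; apply/eqP.
  case: (@arg_minnP _ i0 (fun i => u i != z i) (fun i => i) neq0) => i neq_i min_i.
  exists i => // p lt_pi; apply/eqP; apply: contraTT lt_pi => /min_i.
  by rewrite -leqNgt.
have eq_lt p : p < i -> pv u p = pv z p.
  move=> pi; have lt_p := ltn_trans pi (ltn_ord i).
  by rewrite -[p]/(nat_of_ord (Ordinal lt_p)) !pvE min_i.
have rk_eq q : rk u i q = rk z i q.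
  by rewrite /rk; apply: eq_bigr => p _; rewrite eq_lt.
have lt_i : pv u i < pv z i.
  have := uz i.+1 (pv u i); rewrite !rkS rk_eq leq_add2l leqnn.
  rewrite lt0b => le_uz; rewrite ltn_neqAle le_uz andbT !pvE val_eqE.
  exact: neq_i.
pose P (j : 'I_n) := [&& i < j, pv u i < u j & u j <= pv z i].
have [j0 Pj0] : exists j, P j.
  exists ((u^-1)%g (z i)); rewrite /P permKV -(pvE z) lt_i leqnn !andbT.
  rewrite ltnNge leq_eqVlt negb_or; apply/andP; split.
    by apply: contraNneq neq_i => /ord_inj eq_i; rewrite -{1}eq_i permKV.
  apply/negP=> lt_ji; have := min_i _ lt_ji; rewrite permKV => /perm_inj eq_i.
  by rewrite -eq_i ltnn in lt_ji.
case: (@arg_minnP _ j0 P (fun j => j) Pj0) => j /and3P[ij uij ujz] min_j.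
exists i, j; split=> //; first by rewrite -pvE.
move=> m q; have := rk_tperm u i j m q; rewrite !pvE in uij ujz *.
have := uz m q.
have [im|mi] := ltnP i m; last by lia.
have [mj|jm] := leqP m j; last by lia.
have [qi|iq] := leqP q (u i); first by lia.
have [qj|jq] := leqP q (u j); last by lia.
(* By minimality of j, the entries of [u] at positions i, .., m - 1 avoid [q, z i], whereas [z] has
   the entry z i there. So, passing from the threshold z i + 1 down to q, [z] gains at least one
   more than [u], which pays for the exchange. *)
have win : rk u m q + rk u i (z i).+1 = rk u m (z i).+1 + rk u i q.
  apply: rk_window; [exact: ltnW | lia |] => p /andP[ip pm] qp.
  rewrite ltnNge; apply/negP => le_pz.
  have lt_p : p < n by apply: leq_trans (leq_trans pm mj) (ltnW (ltn_ord j)).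
  have min_p : i < p -> u i < pv u p -> pv u p <= z i -> j <= p.
    rewrite -[p]/(nat_of_ord (Ordinal lt_p)) pvE => p1 p2 p3.
    by apply: min_j; rewrite /P p1 !pvE p2.
  move: ip; rewrite leq_eqVlt => /orP[/eqP eq_ip|ip]; last by lia.
  by move: qp; rewrite -eq_ip pvE; lia.
have := rk_mono2 z im (leqW (leq_trans qj ujz)).
rewrite !rkS !pvE ltnn; have := uz m (z i).+1; rewrite !rk_eq in win *.
by rewrite (leq_trans qj ujz); lia.
Qed.

Lemma bruhat_step_tperm u i j : i < j -> u i < u j ->
  bruhat_step u (u \co tperm i j).
Proof.
move=> ij uij; apply/existsP; exists i; apply/existsP; exists j.
rewrite eqxx /= -{1}(pcompKt u i j) ell_tperm_lt //.
by rewrite !pcompE tpermL tpermR.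
Qed.

(** Each application of [ble_step] adds inversions, and there are at most n * n of them. *)
Lemma ble_bruhat_le u z : ble u z -> bruhat_le u z.
Proof.
have le_nn (x : 'S_n) : ninv x <= n * n.
  apply: (@leq_trans (\sum_(a < n) n)); last by rewrite sum_nat_const card_ord.
  apply: leq_sum => a _; apply: (@leq_trans (\sum_(b < n) 1)).
    by apply: leq_sum => b _; case: (_ && _).
  by rewrite sum_nat_const card_ord muln1.
have [l] := ubnP (n * n - ninv u); elim: l u => // l IHl u lt_l uz.
have [->|/eqP neq] := eqVneq u z; first exact: connect0.
have [i [j [ij uij le_z]]] := ble_step uz neq.
have step := bruhat_step_tperm ij uij.
apply: connect_trans (connect1 step) (IHl _ _ le_z).
have /existsP[a /existsP[b /andP[_]]] := step; rewrite !ellE.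
have := le_nn (u \co tperm i j); move: lt_l; lia.
Qed.

Lemma bruhat_leP u z : bruhat_le u z <-> ble u z.
Proof. by split=> [/bruhat_le_ble|/ble_bruhat_le]. Qed.

Lemma bruhat_lt_ell u z : bruhat_lt u z -> ell u < ell z.
Proof.
case/andP=> neq /connectP[s]; elim: s u neq => [|x s IHs] u /=.
  by move=> neq _ eq; rewrite eq eqxx in neq.
move=> _ /andP[/existsP[a /existsP[b /andP[_ lt_ux]]] path_s] def_z.
have [<-//|neq] := eqVneq x z.
exact: ltn_trans lt_ux (IHs _ neq path_s def_z).
Qed.

Lemma bruhat_covers_tperm w i j : i < j -> (ell (w \co tperm i j)).+1 = ell w ->
  bruhat_covers w (w \co tperm i j).
Proof.
move=> ij cov; apply/andP; split.
  apply/andP; split; first by apply: contra_eq_neq cov => ->; rewrite neq_ltn ltnSn orbT.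
  have [uij _] := (ell_tperm_coverP w ij).1 cov.
  apply: connect1; rewrite -{2}(pcompKt w i j); apply: bruhat_step_tperm => //.
  by rewrite !pcompE tpermL tpermR.
apply/forallP=> y; apply/negP => /andP[/bruhat_lt_ell lt1 /bruhat_lt_ell lt2].
by rewrite -cov ltnS in lt2; rewrite ltnNge lt2 in lt1.
Qed.

End Rank.

(** * One-line notations of v and w, and the interval [v, w] *)

Section Words.
Variable n : nat.
Implicit Types (u z v w : 'S_n) (i j : 'I_n).

Lemma pv_simple z m p : m.+1 < n -> pv (z \co simple_tr n m.+1) p =
  if p == m then pv z m.+1 else if p == m.+1 then pv z m else pv z p.
Proof.
move=> lt_m; rewrite (@simple_tperm n (Ordinal (ltnW lt_m)) (Ordinal lt_m)) //.
by rewrite pv_tperm.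
Qed.

Lemma ell_simple z m : m.+1 < n ->
  ell (z \co simple_tr n m.+1) <= (ell z).+1 /\
  (ell (z \co simple_tr n m.+1) = (ell z).+1 -> pv z m < pv z m.+1).
Proof.
move=> lt_m; pose i := Ordinal (ltnW lt_m); pose j := Ordinal lt_m.
rewrite (@simple_tperm n i j) // !ellE; split; first exact: inv_tperm_adj_le.
rewrite -[pv z m]/(pv z i) -[pv z m.+1]/(pv z j) !pvE.
case: ltngtP => // [uji|/val_inj/perm_inj/(congr1 val) /=]; last by lia.
by have := @inv_tperm_adj_gt n z i j erefl uji; lia.
Qed.

Lemma pv_iota_word t v s p : s + t < n ->
  pv (v \co comp_prod [seq simple_tr n m | m <- iota s.+1 t]) p =
  if s <= p < s + t then pv v p.+1 else if p == s + t then pv v s else pv v p.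
Proof.
elim: t v s => [|t IHt] v s lt_n /=.
  rewrite pcomp1 addn0; have -> : s <= p < s = false by lia.
  by case: eqP => // ->.
rewrite pcompA IHt; last by rewrite addSnnS.
have lt_s : s.+1 < n by lia.
rewrite !pv_simple //; case: (eqVneq p s) => [->|ps].
  by do !case: ifP => //; lia.
by do !case: ifP => //; lia.
Qed.

(** Each factor raises the length by at most one, so a total gain of t makes every factor an ascent:
    the entry carried to the right is smaller than each entry that it passes. *)
Lemma ell_iota_word t v s : s + t < n ->
  let u := v \co comp_prod [seq simple_tr n m | m <- iota s.+1 t] in
  ell u <= ell v + t /\
  (ell u = ell v + t -> forall p, s < p -> p <= s + t -> pv v s < pv v p).
Proof.
elim: t v s => [|t IHt] v s lt_n /=.
  by rewrite pcomp1 addn0; split=> // _ p sp; lia.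
have lt_s : s.+1 < n by lia.
have lt_t : s.+1 + t < n by lia.
rewrite pcompA; have [] := IHt (v \co simple_tr n s.+1) s.+1 lt_t.
have [le1 eq1] := ell_simple v lt_s.
set u := _ \co comp_prod _ => le2 eq2; split; first by lia.
move=> eq_ell p sp pt; have lt_v : pv v s < pv v s.+1 by apply: eq1; lia.
move: sp; rewrite leq_eqVlt => /orP[/eqP <- //|sp].
have := eq2 _ p sp; rewrite !pv_simple // eqxx.
rewrite [s.+1 == s]eqn_leq ltnn /= (gtn_eqF sp) gtn_eqF; last exact: ltnW.
by apply; lia.
Qed.

Lemma pv_rev_word t v p : t < n ->
  pv (v \co comp_prod [seq simple_tr n m | m <- rev (iota 1 t)]) p =
  if p == 0 then pv v t else if p <= t then pv v p.-1 else pv v p.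
Proof.
elim: t v p => [|t IHt] v p lt_n /=.
  by rewrite pcomp1; case: p.
have -> : rev (1 :: iota 2 t) = t.+1 :: rev (iota 1 t).
  by rewrite -[1 :: _]/(iota 1 t.+1) -(addn1 t) iotaD rev_cat /= add1n addn1.
rewrite /= pcompA IHt; last exact: ltnW.
rewrite !pv_simple // eqxx; case: p => [|p] //=.
case: (eqVneq p t) => [->|pt]; first by do !case: ifP => //; lia.
by do !case: ifP => //; lia.
Qed.

Lemma ell_rev_word t v : t < n ->
  let u := v \co comp_prod [seq simple_tr n m | m <- rev (iota 1 t)] in
  ell u <= ell v + t /\
  (ell u = ell v + t -> forall p, p < t -> pv v p < pv v t).
Proof.
elim: t v => [|t IHt] v lt_n /=.
  by rewrite pcomp1 addn0.
have -> : rev (1 :: iota 2 t) = t.+1 :: rev (iota 1 t).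
  by rewrite -[1 :: _]/(iota 1 t.+1) -(addn1 t) iotaD rev_cat /= add1n addn1.
rewrite /= pcompA; have [] := IHt (v \co simple_tr n t.+1) (ltnW lt_n).
have [le1 eq1] := ell_simple v lt_n.
set u := _ \co comp_prod _ => le2 eq2; split; first by lia.
move=> eq_ell p; have lt_v : pv v t < pv v t.+1 by apply: eq1; lia.
rewrite ltnS leq_eqVlt => /orP[/eqP -> //|pt].
have := eq2 _ p pt; rewrite !pv_simple // eqxx.
rewrite (ltn_eqF pt) ltn_eqF; last by lia.
by apply; lia.
Qed.

(* The one-line notation of [w] is obtained from that of [v] by moving the
   entry in position [k] to the front and the one in position [k - 1] to the end;
   each entry that is passed increases the length by one. *)
Definition rotated v w k :=
  [/\ [/\ 1 < k, k.+1 < n & forall p, p < n -> pv w p =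
         if p == 0 then pv v k else if p < k then pv v p.-1
         else if p == n.-1 then pv v k.-1 else pv v p.+1],
      pv w n.-1 < pv w 0,
      forall p, 0 < p < k -> pv w p < pv w 0 &
      forall p, k <= p < n.-1 -> pv w n.-1 < pv w p].

Lemma rotatedP v w k : 4 <= n -> 2 <= k -> k <= n - 2 ->
  w = v \co comp_prod [seq simple_tr n m | m <- iota k (n - k)]
        \co comp_prod [seq simple_tr n m | m <- rev (iota 1 (k - 1))] ->
  ell w = ell v + (n - 1) -> rotated v w k.
Proof.
case: k => // k n4 k2 kn; rewrite subn1 /= => def_w eq_ell.
have lt1 : k + (n - k.+1) < n by lia.
have lt2 : k < n by lia.
have [] := ell_iota_word v lt1.
have := fun p => pv_iota_word v p lt1.
move: def_w; set u := v \co _ => def_w pv_u le_u eq_u.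
have [] := ell_rev_word u lt2; have := fun p => pv_rev_word u p lt2.
rewrite -def_w => pv_w le_w eq_w.
(* The two words have n - 1 letters together, so the total gain n - 1 makes both length bounds
   sharp. *)
have {}eq_u : forall p, k < p -> p <= k + (n - k.+1) -> pv v k < pv v p.
  by apply: eq_u; lia.
have {}eq_w : forall p, p < k -> pv u p < pv u k by apply: eq_w; lia.
have pv_wv p : p < n -> pv w p =
         if p == 0 then pv v k.+1 else if p < k.+1 then pv v p.-1
         else if p == n.-1 then pv v k else pv v p.+1.
  move=> lt_p; rewrite pv_w !pv_u; do !case: ifP => //=; lia.
split=> //.
- by split=> //; lia.
- have -> : pv w 0 = pv v k.+1 by rewrite pv_wv //; lia.
  have -> : pv w n.-1 = pv v k by rewrite pv_wv; [do !case: ifP => //; lia | lia].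
  by apply: eq_u; lia.
- move=> p p_k; have -> : pv w 0 = pv u k by rewrite pv_w.
  have -> : pv w p = pv u p.-1 by rewrite pv_w; do !case: ifP => //; lia.
  by apply: eq_w; lia.
move=> p kp.
have -> : pv w n.-1 = pv v k by rewrite pv_wv; [do !case: ifP => //; lia | lia].
have -> : pv w p = pv v p.+1 by rewrite pv_wv; [do !case: ifP => //; lia | lia].
by apply: eq_u; lia.
Qed.

End Words.

(** Beyond position n only the junk value 0 of [pv] occurs; it counts for q = 0 alone, where every
    rank is m. *)
Lemma bleP n (u z : 'S_n) :
  (forall m q, m <= n -> rk u m q <= rk z m q) -> ble u z.
Proof.
move=> le_uz m q; have [/le_uz//|lt_m] := leqP m n.
case: q => [|q].
  have rk_0 (x : 'S_n) : rk x m 0 = m by rewrite (@rk_high _ x 0) ?rk0 ?subn0.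
  by rewrite !rk_0.
have rk_S (x : 'S_n) : rk x m q.+1 = rk x n q.+1.
  apply: rk_low; first exact: ltnW.
  by move=> p /andP[np _]; rewrite /pv insubN // -leqNgt.
by rewrite !rk_S le_uz.
Qed.

(** * Rank functions of v and w, and the coatom criterion *)

Section Rotated.
Variables (n k : nat) (v w : 'S_n).
Hypothesis vw : rotated v w k.
Implicit Types (z : 'S_n) (i j : 'I_n).

Lemma rot_k : 1 < k /\ k.+1 < n.
Proof. by case: vw => -[]. Qed.

Lemma rot_last : pv w n.-1 < pv w 0.
Proof. by case: vw => _ h1 h2 h3; auto. Qed.

Lemma rot_left p : 0 < p < k -> pv w p < pv w 0.
Proof. by case: vw => _ h1 h2 h3; auto. Qed.

Lemma rot_right p : k <= p < n.-1 -> pv w n.-1 < pv w p.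
Proof. by case: vw => _ h1 h2 h3; auto. Qed.

Lemma pv_rot p : p < n -> pv v p =
  if p < k.-1 then pv w p.+1 else if p == k.-1 then pv w n.-1
  else if p == k then pv w 0 else pv w p.-1.
Proof.
have [k1 kn] := rot_k; have [[_ _ pv_w] _ _ _] := vw => lt_p.
case: ltnP => [pk|pk].
  by rewrite pv_w; [do !case: ifP => //=; lia | lia].
case: eqP => [->|pk1].
  by rewrite pv_w; [do !case: ifP => //=; lia | lia].
case: eqP => [->|pk2].
  by rewrite pv_w; [do !case: ifP => //=; lia | lia].
case: p pk pk1 pk2 lt_p => [|p] pk pk1 pk2 lt_p; first by lia.
by rewrite pv_w; [do !case: ifP => //=; lia | rewrite /=; lia].
Qed.

(* The sets of the first [m] values of [v] and [w] differ by the exchange of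
   [lo m] for [hi m]. *)
Definition lo m := if m < k then pv w m else pv w n.-1.
Definition hi m := if m <= k then pv w 0 else pv w m.-1.

Lemma rk_rot m q : m <= n -> rk w m q + (q <= lo m) = rk v m q + (q <= hi m).
Proof.
have [k1 kn] := rot_k; elim: m => [|m IHm] le_m; first by rewrite !rk0 /lo /hi ifT //; lia.
have := IHm (ltnW le_m); rewrite !rkS pv_rot // /lo /hi /=.
by do !case: ifP => //; lia.
Qed.

Lemma lo_lt_hi m : 0 < m < n -> lo m < hi m.
Proof.
have [k1 kn] := rot_k => m_n; rewrite /lo /hi.
have [mk|mk|mk] := ltngtP m k.
- by apply: rot_left; lia.
- by apply: rot_right; lia.
exact: rot_last.
Qed.

Lemma rot_ble : ble v w.
Proof.
have [k1 kn] := rot_k; apply: bleP => m q le_m; have := rk_rot q le_m.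
case: (posnP m) => [->|m0]; first by rewrite !rk0.
have [mn|mn] := ltnP m n; first by have := @lo_lt_hi m; lia.
have -> : m = n by lia.
have -> : lo n = hi n by rewrite /lo /hi !ifF; lia.
by lia.
Qed.

(** The exchange lowers the rank by one for the prefixes i < m <= j at the thresholds in (w j, w i].
    The ranks of [w] exceed those of [v] exactly at the thresholds in (lo m, hi m], so the first
    interval has to lie in the second. *)
Lemma ble_rot_tpermP i j : i < j -> w j < w i ->
  ble v (w \co tperm i j) <->
  forall m, i < m <= j -> lo m <= w j /\ w i <= hi m.
Proof.
move=> ij wij; split.
  move=> le_v m im; have le_m : m <= n by have := ltn_ord j; lia.
  split.
    have := le_v m (w j).+1; have := rk_tperm w i j m (w j).+1.
    by have := rk_rot (w j).+1 le_m; rewrite !pvE; lia.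
  have := le_v m (w i); have := rk_tperm w i j m (w i).
  by have := rk_rot (w i) le_m; rewrite !pvE; lia.
move=> bnd; apply: bleP => m q le_m.
have := rk_tperm w i j m q; have := rot_ble m q; have := rk_rot q le_m.
rewrite !pvE; have := bnd m; lia.
Qed.

Lemma coatomP i j : i < j -> (ell (w \co tperm i j)).+1 = ell w ->
  coatom v w (w \co tperm i j) <->
  forall p, i < p < j ->
    (p < k -> pv w p < pv w j) /\ (k <= p -> pv w i < pv w p).
Proof.
have [k1 kn] := rot_k => ij cov; have [wij noP] := (ell_tperm_coverP w ij).1 cov.
have le_w : bruhat_le (w \co tperm i j) w.
  apply: connect1; rewrite -{2}(pcompKt w i j); apply: bruhat_step_tperm => //.
  by rewrite !pcompE tpermL tpermR.
have -> : coatom v w (w \co tperm i j) = bruhat_le v (w \co tperm i j).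
  by rewrite /coatom inE le_w bruhat_covers_tperm // !andbT.
split=> [/bruhat_leP/(ble_rot_tpermP ij wij) bnd p ipj | cnd].
  have lt_j := ltn_ord j.
  have neq_j : pv w p != pv w j by apply/eqP => /pv_inj e; have := e; lia.
  have neq_i : pv w p != pv w i by apply/eqP => /pv_inj e; have := e; lia.
  split=> pk.
    by have := bnd p; rewrite /lo pk -!pvE; lia.
  (* The value at a position p >= k appears as [hi] of the prefix of length p + 1, which is longer
     than k. *)
  by have := bnd p.+1; rewrite /hi; case: ifP; rewrite /= -!pvE; lia.
apply/bruhat_leP/ble_rot_tpermP => // m imj; have lt_j := ltn_ord j.
rewrite /lo /hi -!pvE; split.
  (* For m < k the bound on [lo] is the condition at position m, trivial for m = j. For m >= k it
     holds because w(n-1) is the least entry from position k on. The bound on [hi] is the mirror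
     image. *)
  case: (ltnP m k) => mk.
    have [mj|mj] := eqVneq m j; first by rewrite mj.
    by have := cnd m; lia.
  have [jn|jn] := eqVneq (nat_of_ord j) n.-1; first by rewrite jn.
  by rewrite ltnW // rot_right //; lia.
case: (leqP m k) => mk.
  have [i0|i0] := posnP i; first by rewrite i0.
  by rewrite ltnW // rot_left //; lia.
have [mi|mi] := eqVneq m.-1 i; first by rewrite mi.
by have := cnd m.-1; lia.
Qed.

End Rotated.

(** * Nearest smaller and larger entries, and the pairs (1)-(3) *)

Lemma nearest_left (P : pred nat) i0 m : i0 < m -> P i0 ->
  exists i, [/\ i0 <= i, i < m, P i & forall l, i < l < m -> ~~ P l].
Proof.
elim: m => // m IHm; rewrite ltnS => le_i0 Pi0.
have [Pm|nPm] := boolP (P m); first by exists m; split=> // l; lia.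
have lt_i0 : i0 < m.
  by rewrite ltn_neqAle le_i0 andbT; apply: contraNneq nPm => <-.
have [i [le_i lt_i Pi near]] := IHm lt_i0 Pi0; exists i; split=> //; first exact: ltnW.
move=> l il; have [->//|lm] := eqVneq l m; apply: near; lia.
Qed.

Lemma nearest_right (P : pred nat) m j0 : m <= j0 -> P j0 ->
  exists j, [/\ m <= j, j <= j0, P j & forall l, m <= l < j -> ~~ P l].
Proof.
move=> le_m Pj0; have exP : exists j, (m <= j) && P j by exists j0; rewrite le_m.
case: (ex_minnP exP) => j /andP[mj Pj] min_j; exists j; split=> //.
  by apply: min_j; rewrite le_m.
move=> l /andP[ml lj]; apply/negP => Pl; have := min_j l.
by rewrite ml Pl => /(_ isT); lia.
Qed.

Section Coatoms.
Variables (n k : nat) (v w : 'S_n).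
Hypothesis vw : rotated v w k.
Local Notation W := (pv w).

Let W_neq p q : p < n -> q < n -> p != q -> W p != W q.
Proof. by move=> lt_p lt_q; apply: contra_neq; apply: pv_inj. Qed.

(** Conditions (1)-(3) in one formula: the sides of k on which i and j lie tell which of them is
    meant. *)
Definition coatom_pair i j := [/\ i < j, j < n, W j < W i & forall l, i < l < j ->
  (l < k -> W l < W j) /\ (k <= l -> W i < W l)].

Lemma coatom_pair_cover (i j : 'I_n) : coatom_pair i j ->
  (ell (w \co tperm i j)).+1 = ell w.
Proof.
move=> [ij _ wij near]; apply/ell_tperm_coverP => //; rewrite !pvE in wij.
split=> // p ip pj [wjp wpi]; have := near p; rewrite ip pj !pvE.
by case: (ltnP p k) => pk /(_ isT); lia.
Qed.

Lemma coatom_pair_le (i j : 'I_n) : coatom_pair i j -> bruhat_le v (w \co tperm i j).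
Proof.
move=> ij; have /coatomP := coatom_pair_cover ij; case: ij => ij _ _ near.
by case/(_ _ _ vw ij) => _ /(_ near); rewrite /coatom inE => /andP[/andP[]].
Qed.

(** The search to the left for an entry larger than w(m) cannot fail, because w(0) is one. This
    gives the pair (1) ending at m; likewise [right_edge] gives the pair (2) starting at i, with
    w(n-1) as the guaranteed smaller entry. *)
Lemma left_edge m : 0 < m < k -> exists i, [/\ i < m, W m < W i &
  forall l, i < l < m -> W l < W m].
Proof.
have [k1 kn] := rot_k vw => m_k.
have [|i [_ im wi near]] := @nearest_left (fun i => W m < W i) 0 m _ (rot_left vw m_k).
  by lia.
exists i; split=> // l il; have := near l il; rewrite -leqNgt => le_l.
by rewrite ltn_neqAle le_l andbT W_neq; lia.
Qed.

Lemma right_edge i : k <= i < n.-1 -> exists j, [/\ i < j, j < n, W j < W i &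
  forall l, i < l < j -> W i < W l].
Proof.
have [k1 kn] := rot_k vw => i_k.
have [|j [ij jn wj near]] :=
  @nearest_right (fun j => W j < W i) i.+1 n.-1 _ (rot_right vw i_k).
  by lia.
exists j; split=> //; first by lia.
move=> l il; have := near l il; rewrite -leqNgt => le_l.
by rewrite ltn_neqAle le_l andbT W_neq; lia.
Qed.

Lemma last_large : exists p, [/\ p < k, W n.-1 < W p &
  forall l, p < l < k -> W l < W n.-1].
Proof.
have [k1 kn] := rot_k vw.
have [|p [_ pk wp near]] := @nearest_left (fun p => W n.-1 < W p) 0 k _ (rot_last vw).
  by lia.
exists p; split=> // l pl; have := near l pl; rewrite -leqNgt => le_l.
by rewrite ltn_neqAle le_l andbT W_neq; lia.
Qed.

Lemma first_small : exists q, [/\ k <= q, q < n, W q < W 0 &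
  forall l, k <= l < q -> W 0 < W l].
Proof.
have [k1 kn] := rot_k vw.
have [|q [kq qn wq near]] := @nearest_right (fun q => W q < W 0) k n.-1 _ (rot_last vw).
  by lia.
exists q; split=> //; first by lia.
move=> l lq; have := near l lq; rewrite -leqNgt => le_l.
by rewrite ltn_neqAle le_l andbT W_neq; lia.
Qed.

Lemma le_W0 p : p < k -> W p <= W 0.
Proof.
have := @rot_left _ _ _ _ vw p; case: p => [|p] // lt_p p_k.
by rewrite ltnW // lt_p.
Qed.

Lemma ge_Wlast q : k <= q -> q < n -> W n.-1 <= W q.
Proof.
move=> kq qn; have [->//|neq] := eqVneq q n.-1.
by rewrite ltnW // (rot_right vw) //; lia.
Qed.

(** The left entries after p are below w(n-1), hence below every right entry, so p can be paired
    with the first right entry smaller than w(p). *)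
Lemma cross_right p : p < k -> W n.-1 < W p ->
  (forall l, p < l < k -> W l < W n.-1) ->
  exists j, [/\ k <= j, W j < W p & coatom_pair p j].
Proof.
have [k1 kn] := rot_k vw => pk wp near_p.
have [|j [kj jn wj near]] := @nearest_right (fun j => W j < W p) k n.-1 _ wp.
  by lia.
exists j; split=> //; split=> //; [lia|lia|move=> l plj; split=> lk].
  by apply: leq_trans (near_p l _) (ge_Wlast _ _); lia.
have := near l; rewrite -leqNgt => le_l.
by rewrite ltn_neqAle le_l ?andbT ?W_neq; lia.
Qed.

Lemma cross_left q : k <= q -> q < n -> W q < W 0 ->
  (forall l, k <= l < q -> W 0 < W l) ->
  exists i, [/\ i < k, W q < W i & coatom_pair i q].
Proof.
have [k1 kn] := rot_k vw => kq qn wq near_q.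
have [|i [_ ik wi near]] := @nearest_left (fun i => W q < W i) 0 k _ wq.
  by lia.
exists i; split=> //; split=> //; [lia|move=> l ilq; split=> lk].
  have := near l; rewrite -leqNgt => le_l.
  by rewrite ltn_neqAle le_l ?andbT ?W_neq; lia.
by apply: leq_ltn_trans (le_W0 ik) (near_q l _); lia.
Qed.

Lemma cross_exists : exists i j, [/\ i < k, k <= j & coatom_pair i j].
Proof.
have [p [pk wp near]] := last_large.
by have [j [kj _ gd]] := cross_right pk wp near; exists p, j.
Qed.

(** If w(p) <= w(q), the pair (p, j) of [cross_right] has w(j) < w(p) <= w(q), so j differs from q,
    and the pair (i, q) of [cross_left] is a second one. *)
Lemma cross_uniq : (forall i j i' j', i < k -> k <= j -> coatom_pair i j ->
    i' < k -> k <= j' -> coatom_pair i' j' -> i = i' /\ j = j') ->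
  exists p q, [/\ p < k /\ k <= q, q < n, W n.-1 < W p /\ W q < W 0,
     (forall l, p < l < k -> W l < W n.-1) /\
     (forall l, k <= l < q -> W 0 < W l) & W q < W p].
Proof.
have [k1 kn] := rot_k vw => uniq.
have [p [pk wp near_p]] := last_large; have [q [kq qn wq near_q]] := first_small.
exists p, q; split=> //; rewrite ltnNge; apply/negP => le_pq.
have [j [kj wj gj]] := cross_right pk wp near_p.
have [i [ik wi gi]] := cross_left kq qn wq near_q.
have [eq_pi eq_jq] := uniq p j i q pk kj gj ik kq gi.
by rewrite eq_jq in wj; rewrite ltnNge le_pq in wj.
Qed.

End Coatoms.

(** * Facets and vertices when the pair (3) is unique *)

Section Facets.
Variables (n k : nat) (v w : 'S_n).
Hypothesis vw : rotated v w k.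
Local Notation W := (pv w).
Variables p q : nat.
Hypotheses (pk : p < k) (kq : k <= q) (qn : q < n).
Hypotheses (wp : W n.-1 < W p) (wq : W q < W 0) (wqp : W q < W p).
Hypothesis near_p : forall l, p < l < k -> W l < W n.-1.
Hypothesis near_q : forall l, k <= l < q -> W 0 < W l.
Implicit Types z : 'S_n.

Definition between z := ble v z /\ ble z w.

(** Outside (lo m, hi m] the ranks of [v] and [w] agree and squeeze that of [z]. Such thresholds are
    called tight below. *)
Lemma between_tight z m t : between z -> m <= n ->
  (t <= lo k w m) || (hi k w m < t) ->
  rk z m t = rk v m t /\ rk w m t = rk v m t.
Proof.
move=> [vz zw] le_m out; have := vz m t; have := zw m t.
have := rk_rot vw t le_m; have := rot_ble vw m t.
by case/orP: out => out; lia.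
Qed.

Lemma rk_gap m t : m <= n -> lo k w m < t <= hi k w m ->
  rk w m t = rk v m t + 1.
Proof. by move=> le_m; have := rk_rot vw t le_m; lia. Qed.

(* [rk z m (thr m)] takes one of two consecutive values for [z] in [v, w], and this
   bit decides which of the two facets attached to [m] contains [z]. *)
Definition thr m := if m < k then (W m).+1 else if m == k then W p else W m.-1.

(* Facets are listed in an order in which the hyperplane of each of them only
   involves prefix sums attached to earlier ones. *)
Definition ord m :=
  if m < k then (n - W m + (W m < W n.-1) * n.+1).*2
  else if m == k then n.*2 else ((W m.-1 + (W 0 < W m.-1) * n.+1).*2).+1.

(** The sums X_0 and X_n are constant on the polytope, so they may occur in any bound. *)
Definition earlier m t := t <= n /\ [\/ t = 0, t = n | 0 < t < n /\ ord t < ord m].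

(** At each threshold the deficit from [w] at m is at least the deficit at h, and the excess over
    [v] at m is at least the sum of the excesses at g and g'; the place 0 stands for an absent term.
    Equality is needed at all thresholds, but strictness only at [thr m], since the inequalities are
    summed over t afterwards. *)
Record facet_pair m h g g' : Prop := FacetPair {
  facet_h : earlier m h;
  facet_g : earlier m g;
  facet_g' : earlier m g';
  facet_upper : forall z t, between z ->
    rk z m t + rk w h t <= rk w m t + rk z h t;
  facet_upper_eq : forall z t, between z -> rk z m (thr m) = rk w m (thr m) ->
    rk z m t + rk w h t = rk w m t + rk z h t;
  facet_upper_lt : forall z, between z -> rk z m (thr m) < rk w m (thr m) ->
    rk z m (thr m) + rk w h (thr m) < rk w m (thr m) + rk z h (thr m);
  facet_lower : forall z t, between z ->
    rk v m t + rk z g t + rk z g' t <= rk z m t + rk v g t + rk v g' t;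
  facet_lower_eq : forall z t, between z -> rk z m (thr m) < rk w m (thr m) ->
    rk v m t + rk z g t + rk z g' t = rk z m t + rk v g t + rk v g' t;
  facet_lower_lt : forall z, between z -> rk z m (thr m) = rk w m (thr m) ->
    rk v m (thr m) + rk z g (thr m) + rk z g' (thr m) <
    rk z m (thr m) + rk v g (thr m) + rk v g' (thr m) }.

Lemma thr_gap m : 0 < m < n -> lo k w m < thr m <= hi k w m.
Proof.
have [k1 kn] := rot_k vw => m_n; have := lo_lt_hi vw m_n; rewrite /lo /hi /thr.
have := le_W0 vw pk; do 3?case: ifP; lia.
Qed.

Lemma rk_thr m z : 0 < m < n -> between z ->
  rk w m (thr m) = rk v m (thr m) + 1 /\
  (rk z m (thr m) = rk w m (thr m) \/ rk z m (thr m) = rk v m (thr m)).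
Proof.
move=> m_n [vz zw]; have le_m : m <= n by lia.
have := rk_gap le_m (thr_gap m_n); have := vz m (thr m); have := zw m (thr m).
by lia.
Qed.

Lemma pv_v_left l : l < k.-1 -> pv v l = W l.+1.
Proof. by have [k1 kn] := rot_k vw => lk; rewrite (pv_rot vw) ?lk //; lia. Qed.

Lemma pv_v_k1 : pv v k.-1 = W n.-1.
Proof. by have [k1 kn] := rot_k vw; rewrite (pv_rot vw) ?ltnn ?eqxx //; lia. Qed.

Lemma pv_v_k : pv v k = W 0.
Proof.
have [k1 kn] := rot_k vw; rewrite (pv_rot vw); last by lia.
by do !case: ifP => //; lia.
Qed.

Lemma pv_v_right l : k < l < n -> pv v l = W l.-1.
Proof.
have [k1 kn] := rot_k vw => kl; rewrite (pv_rot vw); last by lia.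
by do !case: ifP => //; lia.
Qed.

Lemma ord_left m m' : m < k -> m' < k -> W m < W m' -> ord m' < ord m.
Proof.
move=> mk mk' lt_w; rewrite /ord mk mk'.
have [k1 kn] := rot_k vw; have : W m' < n by apply: pv_lt; lia.
by lia.
Qed.

Lemma ord_right m m' : k < m -> k < m' -> W m.-1 < W m'.-1 -> ord m < ord m'.
Proof.
move=> mk mk' lt_w; rewrite /ord !ltnNge !(ltnW mk) !(ltnW mk') /= !gtn_eqF //.
by lia.
Qed.

Lemma ordk : ord k = n.*2.
Proof. by rewrite /ord ltnn eqxx. Qed.

Lemma ord_p : ord p < ord k.
Proof. by rewrite ordk /ord pk; lia. Qed.

Lemma ord_q : ord q.+1 < ord k.
Proof.
rewrite ordk /ord !ifF /=; try lia.
by have := @pv_lt n w q qn; lia.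
Qed.

Lemma ord_late_left m : p < m < k -> ord k < ord m.
Proof. by move=> pm; rewrite ordk /ord ifT; have := near_p pm; lia. Qed.

Lemma ord_late_right i : k <= i < q -> ord k < ord i.+1.
Proof. by move=> iq; rewrite ordk /ord !ifF /=; have := near_q iq; lia. Qed.

(** The place g is the last larger entry i before m. In [v] the positions i, .., m - 1 hold w(i+1),
    .., w(m), none above w(m), so [v] gains nothing between i and m at thresholds above w(m); the
    thresholds up to w(m) are tight at both places. *)
Lemma facet_left m : 0 < m < k -> exists h g g', facet_pair m h g g'.
Proof.
have [k1 kn] := rot_k vw => m_k; have [i [im wi near_i]] := left_edge vw m_k.
have thrE : thr m = (W m).+1 by rewrite /thr ifT //; lia.
have lo_m : lo k w m = W m by rewrite /lo ifT //; lia.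
have lo_i : lo k w i = W i by rewrite /lo ifT //; lia.
have m_n : 0 < m < n by lia.
have tight_m z t : between z -> t <= W m -> rk z m t = rk v m t /\ rk w m t = rk v m t.
  by move=> bz le_t; apply: between_tight => //; [lia | rewrite lo_m le_t].
have tight_i z t : between z -> t <= W i -> rk z i t = rk v i t.
  move=> bz le_t; suff [] : rk z i t = rk v i t /\ rk w i t = rk v i t by [].
  by apply: between_tight => //; [lia | rewrite lo_i le_t].
have low_v t : W m < t -> rk v m t = rk v i t.
  move=> lt_t; apply: rk_low => [|l il]; first exact: ltnW.
  rewrite pv_v_left; last by lia.
  have [->//|lm] := eqVneq l.+1 m.
  by apply: ltn_trans (near_i l.+1 _) lt_t; lia.
have lower z t : between z ->
    rk v m t + rk z i t + rk z 0 t <= rk z m t + rk v i t + rk v 0 t.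
  move=> bz; rewrite !rk0 !addn0; have [le_t|lt_t] := leqP t (W m).
    by have := tight_m z t bz le_t; have := tight_i z t bz; lia.
  by rewrite (low_v t lt_t); have := rk_mono z t (ltnW im); lia.
have lower_eq z t : between z -> rk z m (thr m) < rk w m (thr m) ->
    rk v m t + rk z i t + rk z 0 t = rk z m t + rk v i t + rk v 0 t.
  move=> bz; have [gapE bitE] := rk_thr m_n bz; rewrite thrE in gapE bitE * => bit0.
  have := lower z t bz; rewrite !rk0 !addn0; have [le_t|lt_t] := leqP t (W m).
    by have := tight_m z t bz le_t; have := tight_i z t bz; lia.
  have := rk_mono2 z (ltnW im) lt_t; have := tight_i z (W m).+1 bz wi.
  by have := low_v _ (ltnSn (W m)); have := low_v t lt_t; lia.
have lower_lt z : between z -> rk z m (thr m) = rk w m (thr m) ->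
    rk v m (thr m) + rk z i (thr m) + rk z 0 (thr m) <
    rk z m (thr m) + rk v i (thr m) + rk v 0 (thr m).
  move=> bz; have [gapE _] := rk_thr m_n bz; rewrite thrE in gapE * => bit1.
  by have := tight_i z (W m).+1 bz wi; rewrite !rk0; lia.
have early_i : earlier m i.
  split; first by lia.
  have [->|i0] := posnP i; first by constructor 1.
  by constructor 3; split; [lia | apply: ord_left => //; lia].
have early_0 t : earlier t 0 by split=> //; constructor 1.
have mk1 : m.+1 <= k by lia.
have k_stop : (k == k) || (W m < W k) by rewrite eqxx.
(* The same argument for [w], looking to the right: up to h no entry of [w] exceeds w(m). It also
   needs the thresholds up to w(m) + 1 to be tight at h, that is, w(m) < lo h. *)
have [h [mh hk hP near_h]] :=
  @nearest_right (fun h => (h == k) || (W m < W h)) m.+1 k mk1 k_stop.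
have low_w t : W m < t -> rk w h t = rk w m t.
    move=> lt_t; apply: rk_low => [|l ml]; first exact: ltnW.
    have [->//|lm] := eqVneq l m.
    by have := near_h l; rewrite negb_or -leqNgt; lia.
  have [lo_h|no_h] := boolP (W m < lo k w h).
    have tight_h z t : between z -> t <= (W m).+1 ->
        rk z h t = rk v h t /\ rk w h t = rk v h t.
      by move=> bz le_t; apply: between_tight => //; [lia | rewrite (leq_trans le_t)].
    exists h, i, 0; split=> //.
    + split; first by lia.
      constructor 3; split; first by lia.
      have [hk1|hk1] := ltnP h k.
        by move: lo_h; rewrite /lo hk1 => lo_h; apply: ord_left; lia.
      have hk2 : h = k by lia.
      rewrite hk2; apply: ord_late_left; move: lo_h; rewrite hk2 /lo ltnn => lo_h.
      apply/andP; split; last by lia.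
      rewrite ltnNge leq_eqVlt; apply/negP => /orP[/eqP mp|mp].
        by rewrite mp in lo_h; lia.
      by have := near_h p; rewrite hk2 negb_or; lia.
    + move=> z t bz; have [le_t|lt_t] := leqP t (W m).
        by have := tight_m z t bz le_t; have := tight_h z t bz (leqW le_t); lia.
      by rewrite (low_w t lt_t); have := rk_mono z t (ltnW mh); lia.
    + move=> z t bz; rewrite thrE => bit1; have [le_t|lt_t] := leqP t (W m).
        by have := tight_m z t bz le_t; have := tight_h z t bz (leqW le_t); lia.
      rewrite (low_w t lt_t); have := rk_mono z t (ltnW mh).
      have := rk_mono2 z (ltnW mh) lt_t; have := tight_h z _ bz (leqnn _).
      by have := low_w _ (ltnSn (W m)); lia.
    move=> z bz; rewrite thrE => bit0; have := tight_h z _ bz (leqnn _).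
    by have := low_w _ (ltnSn (W m)); lia.
  (* Otherwise no entry between m and k exceeds w(m), while w(n-1) <= w(m). The upper bound is then
     the constant given by [w], which is encoded by h = 0. *)
  have hk2 : h = k.
    apply/eqP; move: hP no_h; rewrite /lo; case: eqP => //= hk1.
    by rewrite ifT; lia.
  have wmp : W p <= W m /\ m <= p.
    move: no_h; rewrite hk2 /lo ltnn => no_h.
    have mp : m <= p by rewrite leqNgt; apply/negP => pm; have := near_p (l := m); lia.
    split=> //; move: mp; rewrite leq_eqVlt => /orP[/eqP->//|mp].
    by have := near_h p; rewrite hk2 negb_or -leqNgt; lia.
  have hi_q : hi k w q.+1 = W q by rewrite /hi ifF //; lia.
  exists 0, i, 0; split=> //; rewrite ?thrE.
  + by move=> z t [_ zw]; rewrite !rk0 !addn0.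
  + move=> z t bz bit1; rewrite !rk0 !addn0; have [_ zw] := bz.
    have hi_m : hi k w m = W 0 by rewrite /hi ifT //; lia.
    have [le_t|lt_t] := leqP t (W m); first by have := tight_m z t bz le_t; lia.
    have [lt_t0|le_t0] := ltnP (W 0) t.
      have [] : rk z m t = rk v m t /\ rk w m t = rk v m t; last by lia.
      by apply: between_tight => //; [lia | rewrite hi_m lt_t0 orbT].
    (* The bit controls the rank at the threshold w(m) + 1 only. It is carried to t by comparison
       with the prefix of length q + 1, where all thresholds above w(q) are tight; they include
       both, because w(q) < w(p) <= w(m). *)
    have mq : m <= q.+1 by lia.
    have tight_q t' : W q < t' ->
        rk z q.+1 t' = rk v q.+1 t' /\ rk w q.+1 t' = rk v q.+1 t'.
      by move=> lt_t'; apply: between_tight => //; rewrite hi_q lt_t' orbT.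
    have win : rk w q.+1 (W m).+1 + rk w m t = rk w q.+1 t + rk w m (W m).+1.
      apply: rk_window => // l ml wl.
      have [lm|lm] := eqVneq l m; first by rewrite lm ltnn in wl.
      have [lk|kl] := ltnP l k; first by have := near_h l; rewrite negb_or -leqNgt; lia.
      have [lq|lq] := eqVneq l q; first by rewrite lq in wl; lia.
      by apply: leq_trans le_t0 (ltnW (near_q _)); lia.
    have := rk_mono2 z mq lt_t; have := tight_q t; have := tight_q (W m).+1.
    by have := zw m t; lia.
by move=> z bz; rewrite !rk0 !addn0.
Qed.

(** The lower bound uses p and q + 1. Thresholds up to w(p) are tight at p, those above w(q) at q +
    1; as w(q) < w(p), at each threshold one of the two excesses vanishes, and the other one is at
    most the excess at k. *)
Lemma facet_cross : exists h g g', facet_pair k h g g'.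
Proof.
have [k1 kn] := rot_k vw; have thrE : thr k = W p by rewrite /thr ltnn eqxx.
have k_n : 0 < k < n by lia.
have le_kn : k <= n by lia.
have lo_k : lo k w k = W n.-1 by rewrite /lo ltnn.
have hi_k : hi k w k = W 0 by rewrite /hi leqnn.
have lo_p : lo k w p = W p by rewrite /lo pk.
have hi_s : hi k w q.+1 = W q by rewrite /hi ifF //; lia.
have wp0 : W p <= W 0 by exact: (le_W0 vw pk).
have ks : k <= q.+1 by lia.
have tight_p z t : between z -> t <= W p -> rk z p t = rk v p t /\ rk w p t = rk v p t.
  by move=> bz le_t; apply: between_tight => //; [lia | rewrite lo_p le_t].
have tight_s z t : between z -> W q < t ->
    rk z q.+1 t = rk v q.+1 t /\ rk w q.+1 t = rk v q.+1 t.
  by move=> bz lt_t; apply: between_tight => //; rewrite hi_s lt_t orbT.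
have low_v t : W n.-1 < t -> rk v k t = rk v p t.
  move=> lt_t; apply: rk_low => [|l pl]; first exact: ltnW.
  have [->|lk] := eqVneq l k.-1; first by rewrite pv_v_k1.
  rewrite pv_v_left; last by lia.
  by apply: ltn_trans (near_p _) lt_t; lia.
have high_v t : t <= W p -> rk v q.+1 t = rk v k t + (q.+1 - k).
  move=> le_t; apply: rk_high => // l kl.
  have [->|lk] := eqVneq l k; first by rewrite pv_v_k (leq_trans le_t).
  rewrite pv_v_right; last by lia.
  by apply: leq_trans (leq_trans le_t wp0) (ltnW (near_q _)); lia.
have lower z t : between z ->
    rk v k t + rk z p t + rk z q.+1 t <= rk z k t + rk v p t + rk v q.+1 t.
  move=> bz; have [le_t|lt_t] := leqP t (W p).
    have := tight_p z t bz le_t; have := high_v t le_t.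
    by have := rk_mono z t ks; lia.
  have := tight_s z t bz; have := low_v t; have := rk_mono z t (ltnW pk); lia.
have low_p := low_v _ wp; have high_p := high_v _ (leqnn _).
exists 0, p, q.+1; split; rewrite ?thrE.
- by split=> //; constructor 1.
- split; first by lia.
  have [->|p0] := posnP p; first by constructor 1.
  by constructor 3; split; [lia | exact: ord_p].
- split=> //; have [->|q1n] := eqVneq q.+1 n; first by constructor 2.
  by constructor 3; split; [lia | exact: ord_q].
- by move=> z t [_ zw]; rewrite !rk0 !addn0.
- move=> z t bz bit1; rewrite !rk0 !addn0; have [_ zw] := bz.
  have [le_tb|lt_tb] := leqP t (W n.-1).
    have [] : rk z k t = rk v k t /\ rk w k t = rk v k t; last by lia.
    by apply: between_tight => //; rewrite lo_k le_tb.
  have [lt_ta|le_ta] := ltnP (W 0) t.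
    have [] : rk z k t = rk v k t /\ rk w k t = rk v k t; last by lia.
    by apply: between_tight => //; rewrite hi_k lt_ta orbT.
  have [le_t|lt_t] := leqP t (W p).
    have win : rk w k t + rk w p (W p) = rk w k (W p) + rk w p t.
      apply: rk_window => //; first exact: ltnW.
      move=> l pl wl; have [->//|lp] := eqVneq l p.
      by have := near_p (l := l); lia.
    have := rk_mono2 z (ltnW pk) le_t; have := tight_p z t bz le_t.
    by have := tight_p z _ bz (leqnn _); have := zw k t; lia.
  have win : rk w q.+1 (W p) + rk w k t = rk w q.+1 t + rk w k (W p).
    apply: rk_window => //; first exact: ltnW.
    move=> l kl wl; have [lq|lq] := eqVneq l q; first by rewrite lq in wl; lia.
    by apply: leq_trans le_ta (ltnW (near_q _)); lia.
  have := rk_mono2 z ks (ltnW lt_t); have := tight_s z t bz.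
  by have := tight_s z _ bz wqp; have := zw k t; lia.
- by move=> z bz; rewrite !rk0 !addn0.
- exact: lower.
- move=> z t bz bit0; have := lower z t bz.
  have [gapE bitE] := rk_thr k_n bz; rewrite thrE in gapE bitE.
  have [pE _] := tight_p z _ bz (leqnn _); have [sE _] := tight_s z _ bz wqp.
  have [le_t|lt_t] := leqP t (W p).
    have := rk_mono2 z ks le_t; have := tight_p z t bz le_t.
    by have := high_v t le_t; lia.
  have := rk_mono2 z (ltnW pk) (ltnW lt_t); have := tight_s z t bz.
  by have := low_v t; lia.
move=> z bz bit1; have [gapE bitE] := rk_thr k_n bz; rewrite thrE in gapE bitE.
have [pE _] := tight_p z _ bz (leqnn _); have [sE _] := tight_s z _ bz wqp.
by lia.
Qed.

(** The mirror image of [facet_left] under reversal of positions and of values. The prefix of length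
    m now belongs to its last entry, in position m - 1, so an edge (m - 1, j) gives the place j + 1,
    possibly n. *)
Lemma facet_right m : k < m < n -> exists h g g', facet_pair m h g g'.
Proof.
have [k1 kn] := rot_k vw => m_k; have i_k : k <= m.-1 < n.-1 by lia.
have [j [ij jn wj near_j]] := right_edge vw i_k.
have thrE : thr m = W m.-1 by rewrite /thr !ifF //; lia.
have hi_m : hi k w m = W m.-1 by rewrite /hi ifF //; lia.
have hi_j : hi k w j.+1 = W j by rewrite /hi ifF //; lia.
have lo_m : lo k w m = W n.-1 by rewrite /lo ifF //; lia.
have m_n : 0 < m < n by lia.
have le_mn : m <= n by lia.
have mj : m <= j.+1 by lia.
have tight_m z t : between z -> W m.-1 < t -> rk z m t = rk v m t /\ rk w m t = rk v m t.
  by move=> bz lt_t; apply: between_tight => //; rewrite hi_m lt_t orbT.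
have tight_j z t : between z -> W j < t -> rk z j.+1 t = rk v j.+1 t.
  move=> bz lt_t; suff [] : rk z j.+1 t = rk v j.+1 t /\ rk w j.+1 t = rk v j.+1 t by [].
  by apply: between_tight => //; rewrite hi_j lt_t orbT.
have high_v t : t <= W m.-1 -> rk v j.+1 t = rk v m t + (j.+1 - m).
  move=> le_t; apply: rk_high => // l ml; rewrite pv_v_right; last by lia.
  have [->//|lm] := eqVneq l m.
  by apply: leq_trans le_t (ltnW (near_j _ _)); lia.
have lower z t : between z ->
    rk v m t + rk z j.+1 t + rk z 0 t <= rk z m t + rk v j.+1 t + rk v 0 t.
  move=> bz; rewrite !rk0 !addn0; have [le_t|lt_t] := leqP t (W m.-1).
    by have := high_v t le_t; have := rk_mono z t mj; lia.
  by have := tight_m z t bz lt_t; have := tight_j z t bz; lia.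
have lower_eq z t : between z -> rk z m (thr m) < rk w m (thr m) ->
    rk v m t + rk z j.+1 t + rk z 0 t = rk z m t + rk v j.+1 t + rk v 0 t.
  move=> bz; have [gapE bitE] := rk_thr m_n bz; rewrite thrE in gapE bitE * => bit0.
  have := lower z t bz; rewrite !rk0 !addn0; have [le_t|lt_t] := leqP t (W m.-1).
    have := rk_mono2 z mj le_t; have := tight_j z _ bz wj.
    by have := high_v t le_t; have := high_v _ (leqnn (W m.-1)); lia.
  by have := tight_m z t bz lt_t; have := tight_j z t bz; lia.
have lower_lt z : between z -> rk z m (thr m) = rk w m (thr m) ->
    rk v m (thr m) + rk z j.+1 (thr m) + rk z 0 (thr m) <
    rk z m (thr m) + rk v j.+1 (thr m) + rk v 0 (thr m).
  move=> bz; have [gapE _] := rk_thr m_n bz; rewrite thrE in gapE * => bit1.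
  by have := tight_j z _ bz wj; rewrite !rk0; lia.
have early_j : earlier m j.+1.
  split; first by lia.
  have [->|j1n] := eqVneq j.+1 n; first by constructor 2.
  by constructor 3; split; [lia | apply: ord_right => //; lia].
have early_0 t : earlier t 0 by split=> //; constructor 1.
have k_m : k.-1 < m.-1 by lia.
have k_stop : (k.-1 < k) || (W k.-1 < W m.-1) by apply/orP; left; lia.
have [l0 [kl li lP near_l]] :=
  @nearest_left (fun l => (l < k) || (W l < W m.-1)) k.-1 m.-1 k_m k_stop.
have hm : l0.+1 <= m by lia.
have high_w t : t <= W m.-1 -> rk w m t = rk w l0.+1 t + (m - l0.+1).
  move=> le_t; apply: rk_high => // l ll.
  have [->//|lm] := eqVneq l m.-1.
  by have := near_l l; rewrite negb_or -!leqNgt; lia.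
have [hi_h|no_h] := boolP (hi k w l0.+1 < W m.-1).
  have tight_h z t : between z -> W m.-1 <= t ->
      rk z l0.+1 t = rk v l0.+1 t /\ rk w l0.+1 t = rk v l0.+1 t.
    move=> bz le_t; apply: between_tight => //; first by lia.
    by rewrite (leq_trans hi_h le_t) orbT.
  exists l0.+1, j.+1, 0; split=> //; rewrite ?thrE.
  - split; first by lia.
    constructor 3; split; first by lia.
    have [lk|kl0] := ltnP l0 k.
      have lk1 : l0.+1 = k by lia.
      move: hi_h; rewrite lk1 /hi leqnn => hi_h; have -> : m = m.-1.+1 by lia.
      apply: ord_late_right; have [//|qm] := ltnP m.-1 q; first by lia.
      move: qm; rewrite leq_eqVlt => /orP[/eqP qm|qm]; first by rewrite -qm in hi_h; lia.
      by have := near_l q; rewrite negb_or -!leqNgt; lia.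
    by move: hi_h; rewrite /hi ifF => [hi_h|]; [apply: ord_right; rewrite /=; lia | lia].
  - move=> z t bz; have [le_t|lt_t] := leqP t (W m.-1).
      by have := high_w t le_t; have := rk_mono z t hm; lia.
    by have := tight_m z t bz lt_t; have := tight_h z t bz (ltnW lt_t); lia.
  - move=> z t bz bit1; have [le_t|lt_t] := leqP t (W m.-1).
      have := high_w t le_t; have := rk_mono z t hm; have := rk_mono2 z hm le_t.
      by have := high_w _ (leqnn _); have := tight_h z _ bz (leqnn _); lia.
    by have := tight_m z t bz lt_t; have := tight_h z t bz (ltnW lt_t); lia.
  move=> z bz bit0; have := high_w _ (leqnn _).
  by have := tight_h z _ bz (leqnn _); lia.
have lk1 : l0.+1 = k.
  have [lk|kl0] := ltnP l0 k; first by lia.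
  by move: lP no_h; rewrite /hi ifF /=; lia.
move: no_h; rewrite lk1 /hi leqnn -leqNgt => no_h.
have qm : q <= m.-1.
  by rewrite leqNgt; apply/negP => mq; have := near_q (l := m.-1); lia.
have wmq : W m.-1 <= W q.
  move: qm; rewrite leq_eqVlt => /orP[/eqP-> //|qm].
  by have := near_l q; rewrite negb_or -!leqNgt; lia.
have lo_p : lo k w p = W p by rewrite /lo pk.
have pm : p <= m by lia.
exists 0, j.+1, 0; split=> //; rewrite ?thrE.
- by move=> z t [_ zw]; rewrite !rk0 !addn0.
- move=> z t bz bit1; rewrite !rk0 !addn0; have [_ zw] := bz.
  have [le_t|lt_t] := leqP t (W m.-1); last by have := tight_m z t bz lt_t; lia.
  have [le_tb|lt_tb] := leqP t (W n.-1).
    have [] : rk z m t = rk v m t /\ rk w m t = rk v m t; last by lia.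
    by apply: between_tight => //; rewrite lo_m le_tb.
  have tight_p t' : t' <= W p -> rk z p t' = rk v p t' /\ rk w p t' = rk v p t'.
    by move=> le_t'; apply: between_tight => //; [lia | rewrite lo_p le_t'].
  have win : rk w m t + rk w p (W m.-1) = rk w m (W m.-1) + rk w p t.
    apply: rk_window => // l pl wl.
    have [lp|lp] := eqVneq l p; first by rewrite lp; lia.
    have [lk|kl0] := ltnP l k; first by have := near_p (l := l); lia.
    have [->//|lm] := eqVneq l m.-1.
    by have := near_l l; rewrite negb_or -!leqNgt; lia.
  have := rk_mono2 z pm le_t; have := tight_p t; have := tight_p (W m.-1).
  by have := zw m t; lia.
by move=> z bz; rewrite !rk0 !addn0.
Qed.

Lemma facet_exists m : 0 < m < n -> exists h g g', facet_pair m h g g'.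
Proof.
move=> m_n; have [mk|km|->] := ltngtP m k; last exact: facet_cross.
  by apply: facet_left; lia.
by apply: facet_right; lia.
Qed.

(** The endpoint, in the edge attached to m, that determines m: the right one for m < k, the left
    one for m > k. Distinct m other than k have distinct children. *)
Definition child m := if m < k then m else m.-1.

Lemma flip_between z (i j : 'I_n) : between z -> i < j -> pv z j < pv z i ->
  (forall t x, i < t <= j -> pv z j < x <= pv z i -> rk v t x < rk z t x) ->
  between (z \co tperm i j).
Proof.
move=> [vz zw] ij zij lt_rk; split=> t x; have := rk_tperm z i j t x.
  by have := vz t x; have := lt_rk t x; lia.
by have := zw t x; lia.
Qed.

(** Going down the edge attached to m clears the bit of m alone. The last clause preserves the
    entries that the flips later in [ord] rely on through [quiet]. *)
Definition flips z m (i j : 'I_n) :=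
  [/\ between (z \co tperm i j),
      forall m', 0 < m' < n ->
        rk (z \co tperm i j) m' (thr m') + (m' == m) = rk z m' (thr m') &
      forall m', 0 < m' < n -> m' != k -> ord m < ord m' ->
        (child m' != i) && (child m' != j)].

Definition quiet z m := forall m', 0 < m' < n -> m' != k ->
  m' = m \/ ord m < ord m' -> pv z (child m') = W (child m').

Lemma rk_step z i t x : i < t -> (forall l, i < l < t -> pv z l < x) ->
  rk z t x = rk z i x + (x <= pv z i).
Proof. by move=> it low; rewrite -rkS; apply: rk_low. Qed.

(** By [quiet], the entries after i up to m are still those of [w], so none exceeds w(m). Above
    w(m), [z] has one more entry than [v] among the first m but equally many among the first i; the
    surplus entry is z(i), so (i, m) is an inversion of [z]. *)
Lemma flip_left z m : 0 < m < k -> between z -> rk z m (thr m) = rk w m (thr m) ->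
  quiet z m -> exists i j, flips z m i j.
Proof.
have [k1 kn] := rot_k vw => m_k bz bit1 qz.
have [i [im wi near_i]] := left_edge vw m_k.
have mn : m < n by lia.
have m_n : 0 < m < n by lia.
have mk : m < k by lia.
have thr_left m' : m' < k -> thr m' = (W m').+1 by rewrite /thr => ->.
have z_eq l : i < l <= m -> pv z l = W l.
  move=> il; have := qz l; rewrite /child ifT; last by lia.
  apply; [lia | lia |]; have [->|lm] := eqVneq l m; [by left | right].
  by apply: ord_left; [lia | lia | apply: near_i; lia].
have z_small l x : i < l < m -> W m <= x -> pv z l < x.
  move=> il; rewrite z_eq; last by lia.
  by apply: leq_trans; apply: near_i.
have low_v t x : i < t <= m -> W m < x -> rk v t x = rk v i x.
  move=> it lt_x; apply: rk_low => [|l il]; first by lia.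
  rewrite pv_v_left; last by lia.
  have [->//|lm] := eqVneq l.+1 m.
  by apply: ltn_trans (near_i l.+1 _) lt_x; lia.
have low_z t x : i < t <= m -> W m <= x -> rk z t x = rk z i x + (x <= pv z i).
  by move=> it le_x; apply: rk_step => [|l il]; [lia | apply: z_small; lia].
have zm : pv z m = W m by apply: z_eq; lia.
have zi : W m < pv z i.
  have [gapE _] := rk_thr m_n bz; rewrite thr_left // in gapE bit1.
  have [iE _] : rk z i (W m).+1 = rk v i (W m).+1 /\ rk w i (W m).+1 = rk v i (W m).+1.
    by apply: between_tight => //; [lia | rewrite /lo ifT; lia].
  have it : i < m <= m by rewrite im leqnn.
  by have := low_z m _ it (leqnSn (W m)); have := low_v m _ it (ltnSn _); lia.
exists (Ordinal (ltn_trans im mn)), (Ordinal mn); split.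
- apply: flip_between => //=; first by rewrite zm.
  move=> t x it; rewrite zm => /andP[lt_x x_z]; have [vz _] := bz.
  by rewrite (low_v t x it lt_x) (low_z t x it (ltnW lt_x)) x_z addn1 ltnS.
- move=> m' m'_n; have := rk_tperm z (Ordinal (ltn_trans im mn)) (Ordinal mn) m' (thr m').
  rewrite /= zm; have [->|m'm] := eqVneq m' m; first by rewrite thr_left //; lia.
  have [im'|im'] := ltnP i m'; last by lia.
  have [m'm2|m'm2] := ltnP m m'; first by lia.
  (* A place strictly between i and m has threshold w(m') + 1 <= w(m), below the affected range
     (w(m), z(i)]. *)
  by rewrite thr_left; [have := near_i m'; lia | lia].
move=> m' m'_n m'k lt_ord; rewrite /child /=.
have [m'k2|m'k2] := ltnP m' k; last by lia.
apply/andP; split; apply/eqP => e; last by rewrite e ltnn in lt_ord.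
by have := ord_left mk (ltn_trans im mk) wi; rewrite -e; lia.
Qed.

Lemma flip_right z m : k < m < n -> between z -> rk z m (thr m) = rk w m (thr m) ->
  quiet z m -> exists i j, flips z m i j.
Proof.
have [k1 kn] := rot_k vw => m_k bz bit1 qz; have i_k : k <= m.-1 < n.-1 by lia.
have [j [ij jn wj near_j]] := right_edge vw i_k.
have m_n : 0 < m < n by lia.
have km : k < m by lia.
have mn1 : m.-1 < n by lia.
have thr_right m' : k < m' -> thr m' = W m'.-1 by move=> ?; rewrite /thr !ifF; lia.
have z_eq l : m.-1 <= l < j -> pv z l = W l.
  move=> lj; have := qz l.+1; rewrite /child ifF /=; last by lia.
  apply; [lia | lia |]; have [->|lm] := eqVneq l.+1 m; [by left | right].
  by apply: ord_right; [lia | lia | apply: near_j; rewrite /=; lia].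
have z_large l x : m.-1 <= l < j -> x <= W m.-1 -> x <= pv z l.
  move=> lj le_x; rewrite z_eq //; have [->//|lm] := eqVneq l m.-1.
  by apply: leq_trans le_x (ltnW (near_j _ _)); lia.
have high_v t x : m <= t <= j -> x <= W m.-1 ->
    rk v j.+1 x = rk v t x + (j.+1 - t).
  move=> tj le_x; apply: rk_high => [|l tl]; first by lia.
  rewrite pv_v_right; last by lia.
  have [->//|lm] := eqVneq l.-1 m.-1.
  by apply: leq_trans le_x (ltnW (near_j _ _)); lia.
have high_z t x : m <= t <= j -> x <= W m.-1 ->
    rk z j.+1 x = rk z t x + (j - t) + (x <= pv z j).
  move=> tj le_x; rewrite rkS; congr (_ + _); apply: rk_high => [|l tl]; first by lia.
  by apply: z_large; lia.
have zi : pv z m.-1 = W m.-1 by apply: z_eq; lia.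
have mj : m <= m <= j by lia.
have zj : pv z j < W m.-1.
  have [gapE _] := rk_thr m_n bz; rewrite thr_right // in gapE bit1.
  have [jE _] : rk z j.+1 (W m.-1) = rk v j.+1 (W m.-1) /\
                rk w j.+1 (W m.-1) = rk v j.+1 (W m.-1).
    apply: between_tight => //; rewrite /hi ifF /=; last by lia.
    by rewrite wj orbT.
  by have := high_z m _ mj (leqnn _); have := high_v m _ mj (leqnn _); lia.
exists (Ordinal mn1), (Ordinal jn); split.
- apply: flip_between => //=; first by rewrite zi.
  move=> t x tj; rewrite zi => /andP[z_x le_x]; have [vz _] := bz.
  have tj2 : m <= t <= j by lia.
  have := vz j.+1 x; rewrite (high_v t x tj2 le_x) (high_z t x tj2 le_x).
  by lia.
- move=> m' m'_n; have := rk_tperm z (Ordinal mn1) (Ordinal jn) m' (thr m').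
  rewrite /= zi; have [->|m'm] := eqVneq m' m; first by rewrite thr_right //; lia.
  have [im'|im'] := ltnP m.-1 m'; last by lia.
  have [m'j|m'j] := ltnP j m'; first by lia.
  by rewrite thr_right; [have := near_j m'.-1; lia | lia].
move=> m' m'_n m'k lt_ord; rewrite /child /=.
have [m'k2|m'k2] := ltnP m' k; first by lia.
apply/andP; split; apply/eqP => e.
  have e2 : m' = m by lia.
  by rewrite e2 ltnn in lt_ord.
have km' : k < m' by lia.
by have := ord_right km' km; rewrite e => /(_ wj); lia.
Qed.

(** Earlier flips may have changed the entries at p and q, so these are only located: z(p) in
    [w(p), w(0)] and z(q) in [w(n-1), w(p)). *)
Lemma flip_cross z : between z -> rk z k (thr k) = rk w k (thr k) ->
  quiet z k -> exists i j, flips z k i j.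
Proof.
have [k1 kn] := rot_k vw => bz bit1 qz.
have thrE : thr k = W p by rewrite /thr ltnn eqxx.
have k_n : 0 < k < n by lia.
have pn : p < n by lia.
have wp0 : W p <= W 0 by exact: (le_W0 vw pk).
have z_left l : p < l < k -> pv z l = W l.
  move=> pl; have := qz l; rewrite /child ifT; last by lia.
  by apply; [lia | lia | right; apply: ord_late_left].
have z_right l : k <= l < q -> pv z l = W l.
  move=> lq; have := qz l.+1; rewrite /child ifF /=; last by lia.
  by apply; [lia | lia | right; apply: ord_late_right].
have low_z t x : p < t <= k -> W n.-1 <= x -> rk z t x = rk z p x + (x <= pv z p).
  move=> pt le_x; apply: rk_step => [|l pl]; first by lia.
  by rewrite z_left; [apply: leq_trans le_x; apply: near_p; lia | lia].
have high_z t x : k <= t <= q -> x <= W 0 -> rk z t x = rk z k x + (t - k).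
  move=> tq le_x; apply: rk_high => [|l kl]; first by lia.
  by rewrite z_right; [apply: leq_trans le_x (ltnW (near_q _)); lia | lia].
have low_v t x : p < t <= k -> W n.-1 < x -> rk v t x = rk v p x.
  move=> pt lt_x; apply: rk_low => [|l pl]; first by lia.
  have [->|lk] := eqVneq l k.-1; first by rewrite pv_v_k1.
  rewrite pv_v_left; last by lia.
  by apply: ltn_trans (near_p _) lt_x; lia.
have high_v t x : k <= t <= q.+1 -> x <= W 0 -> rk v t x = rk v k x + (t - k).
  move=> tq le_x; apply: rk_high => [|l kl]; first by lia.
  have [->|lk] := eqVneq l k; first by rewrite pv_v_k.
  rewrite pv_v_right; last by lia.
  by apply: leq_trans le_x (ltnW (near_q _)); lia.
have [gapE _] := rk_thr k_n bz; rewrite thrE in gapE bit1.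
have kk : p < k <= k by lia.
have zp : W p <= pv z p.
  have [pE _] : rk z p (W p) = rk v p (W p) /\ rk w p (W p) = rk v p (W p).
    by apply: between_tight => //; [lia | rewrite /lo pk leqnn].
  by have := low_z k _ kk (ltnW wp); have := low_v k _ kk wp; lia.
have zp0 : pv z p <= W 0.
  have tight t : t <= k -> rk z t (W 0).+1 = rk v t (W 0).+1.
    move=> tk; suff [] : rk z t (W 0).+1 = rk v t (W 0).+1 /\
      rk w t (W 0).+1 = rk v t (W 0).+1 by [].
    by apply: between_tight => //; [lia | rewrite /hi tk leqnn orbT].
  have := tight p.+1 pk; have := tight p (ltnW pk).
  have := low_v p.+1 (W 0).+1; have := rot_last vw; rewrite !rkS; lia.
have zq : pv z q < W p.
  have [sE _] : rk z q.+1 (W p) = rk v q.+1 (W p) /\ rk w q.+1 (W p) = rk v q.+1 (W p).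
    by apply: between_tight => //; rewrite /hi ifF /= ?wqp ?orbT //; lia.
  have q1 : k <= q.+1 <= q.+1 by lia.
  have q2 : k <= q <= q by lia.
  have := high_v _ _ q1 wp0; have := high_z _ _ q2 wp0; move: sE; rewrite rkS.
  by lia.
have zqb : W n.-1 <= pv z q.
  have tight t : k <= t <= n -> rk z t (W n.-1) = rk v t (W n.-1).
    move=> tk; suff [] : rk z t (W n.-1) = rk v t (W n.-1) /\
      rk w t (W n.-1) = rk v t (W n.-1) by [].
    by apply: between_tight => //; [lia | rewrite /lo ifF ?leqnn //; lia].
  have := tight q.+1; have := tight q; rewrite !rkS.
  have q1 : k <= q.+1 <= q.+1 by lia.
  have q2 : k <= q <= q.+1 by lia.
  have := high_v _ _ q1 (ltnW (rot_last vw)); have := high_v _ _ q2 (ltnW (rot_last vw)).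
  by rewrite rkS; lia.
exists (Ordinal pn), (Ordinal qn); split.
- apply: flip_between => //=; [by lia | by lia |].
  move=> t x tq x_z; have [vz _] := bz.
  have lt_x : W n.-1 < x by lia.
  have le_x : x <= W 0 by lia.
  have low_k t' : p < t' <= k -> rk v t' x < rk z t' x.
    move=> pt; rewrite (low_v t' x pt lt_x) (low_z t' x pt (ltnW lt_x)).
    by have := vz p x; lia.
  have [tk|kt] := leqP t k; first by apply: low_k; lia.
  have tq1 : k <= t <= q.+1 by lia.
  have tq2 : k <= t <= q by lia.
  by rewrite (high_v t x tq1 le_x) (high_z t x tq2 le_x) ltn_add2r low_k.
- move=> m' m'_n; have := rk_tperm z (Ordinal pn) (Ordinal qn) m' (thr m') => /=.
  have [->|m'm] := eqVneq m' k; first by rewrite thrE; lia.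
  have [im'|im'] := ltnP p m'; last by lia.
  have [m'j|m'j] := ltnP q m'; first by lia.
  (* Between p and q the thresholds on the left are at most w(n-1) <= z(q), those on the right
     exceed w(0) >= z(p): none lies in the affected range. *)
  rewrite /thr; case: ltnP => m'k; first by have := near_p (l := m'); lia.
  by rewrite ifF; [have := near_q (l := m'.-1); lia | lia].
move=> m' m'_n m'k lt_ord; rewrite /child /=; have := ord_p; have := ord_q.
have [m'k2|m'k2] := ltnP m' k => oq op; apply/andP; split; apply/eqP => e; try lia.
  by rewrite -e in op; lia.
have e2 : m' = q.+1 by lia.
by rewrite -e2 in oq; lia.
Qed.

Lemma flip_exists z m : 0 < m < n -> between z -> rk z m (thr m) = rk w m (thr m) ->
  quiet z m -> exists i j, flips z m i j.
Proof.
move=> m_n; have [mk|km|->] := ltngtP m k; last exact: flip_cross.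
  by apply: flip_left; lia.
by apply: flip_right; lia.
Qed.

(** Parity separates the two sides of k, and the shift by n + 1 exceeds every value, which separates
    the places before k from those after it. *)
Lemma ord_inj m m' : 0 < m < n -> 0 < m' < n -> ord m = ord m' -> m = m'.
Proof.
have [k1 kn] := rot_k vw => m_n m'_n; rewrite /ord.
have lt_m : W m < n by apply: pv_lt; lia.
have lt_m1 : W m.-1 < n by apply: pv_lt; lia.
have lt_m' : W m' < n by apply: pv_lt; lia.
have lt_m1' : W m'.-1 < n by apply: pv_lt; lia.
have neq x : x < k -> W x != W n.-1.
  by move=> xk; apply/eqP => /pv_inj e; have := e; lia.
have [mk|mk|mk] := ltngtP m k; have [mk'|mk'|mk'] := ltngtP m' k.
- have [b1|b1] := ltnP (W m); have [b2|b2] := ltnP (W m') => E;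
    by apply: (@pv_inj _ w); lia.
- by lia.
- by have := neq m mk; have [b1|b1] := ltnP (W m); lia.
- by lia.
- have [b1|b1] := ltnP (W 0) (W m.-1); have [b2|b2] := ltnP (W 0) (W m'.-1) => E;
    by suff : m.-1 = m'.-1; [lia | apply: (@pv_inj _ w); lia].
- by lia.
- by have := neq m' mk'; have [b1|b1] := ltnP (W m'); lia.
- by lia.
by lia.
Qed.

(* Going down from [w], the edges are used in the order of [ord], so that the
   edge to be used has kept its original position. *)
Lemma all_bits (B : {set 'I_n}) : (forall m, m \in B -> 0 < m) ->
  exists z, between z /\ forall m : 'I_n, 0 < m ->
    rk z m (thr m) + (m \in B) = rk w m (thr m).
Proof.
have [k1 kn] := rot_k vw.
suff [l lB] : exists l, #|B| <= l.
  (* The third clause strengthens the induction: it makes the permutation built so far [quiet] for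
     the next flip. *)
  move=> B0; suff [z [bz bitz _]] : exists z, [/\ between z,
      forall m : 'I_n, 0 < m -> rk z m (thr m) + (m \in B) = rk w m (thr m) &
      forall m : 'I_n, 0 < m -> m != k :> nat -> m \notin B ->
        (forall l, l \in B -> ord l <= ord m) -> pv z (child m) = W (child m)].
    by exists z.
  elim: l B lB B0 => [|l IHl] B lB B0.
    have -> : B = finset.set0 by apply/eqP; rewrite -cards_eq0 -leqn0.
    exists w; split=> // [|m _]; last by rewrite inE addn0.
    by split=> //; exact: rot_ble vw.
  have [->|/set0Pn[m0 m0B]] := eqVneq B finset.set0.
    exists w; split=> // [|m _]; last by rewrite inE addn0.
    by split=> //; exact: rot_ble vw.
  case: (@arg_maxnP _ m0 (mem B) (fun m => ord m) m0B) => m mB max_m.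
  have mB' : m \in B by [].
  have m_n : 0 < m < n by rewrite (B0 m mB') ltn_ord.
  have [||z [bz bitz fixz]] := IHl (B :\ m).
  - by move: lB; rewrite (cardsD1 m B) mB'.
  - by move=> i; rewrite !inE => /andP[_ /B0].
  have bit1 : rk z m (thr m) = rk w m (thr m).
    by rewrite -bitz ?B0 // !inE eqxx addn0.
  have qz : quiet z m.
    move=> m' m'_n m'k lt_ord; have lt_m' : m' < n by lia.
    have := fixz (Ordinal lt_m'); apply=> //=; first by lia.
      rewrite !inE negb_and negbK -val_eqE /= -implyNb; apply/implyP => neq.
      apply/negP => m'B; have := max_m _ m'B; case: lt_ord => [e|/=]; last by lia.
      by rewrite e eqxx in neq.
    move=> l0; rewrite !inE => /andP[_ l0B]; have := max_m _ l0B.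
    by case: lt_ord => [->|/=] //; lia.
  have [i [j [bz' bits' far]]] := flip_exists m_n bz bit1 qz.
  exists (z \co tperm i j); split=> //.
    move=> m' m'0; have m'_n : 0 < m' < n by rewrite m'0 ltn_ord.
    have := bits' m' m'_n; have := bitz m' m'0; rewrite !inE val_eqE.
    by have [->|_] := eqVneq m' m; rewrite ?mB' /=; lia.
  move=> m' m'0 m'k m'B le_m'; have m'_n : 0 < m' < n by rewrite m'0 ltn_ord.
  have neq : m' != m by apply: contraNneq m'B => ->.
  have lt_ord : ord m < ord m'.
    rewrite ltn_neqAle le_m' // andbT; apply/eqP => /ord_inj e.
    by move: neq; rewrite -val_eqE /= e ?eqxx.
  have /andP[ci cj] := far m' m'_n m'k lt_ord.
  rewrite pv_tperm (negPf ci) (negPf cj); apply: fixz => //.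
    by rewrite !inE neq.
  by move=> l0; rewrite !inE => /andP[_ /le_m'].
by exists #|B|.
Qed.

End Facets.

(** * Combinatorial cubes *)

Section CubeLike.
Local Open Scope ring_scope.
Local Open Scope classical_set_scope.
Variable R : realType.

Definition dot n (c x : 'rV[R]_n) : R := \sum_i c 0 i * x 0 i.

Definition affine n (f : 'rV[R]_n -> R) : Prop :=
  exists c b, forall x, f x = b + dot c x.

Lemma dotDl n (c c' x : 'rV[R]_n) : dot (c + c') x = dot c x + dot c' x.
Proof. by rewrite /dot -big_split; apply: eq_bigr => i _; rewrite mxE mulrDl. Qed.

Lemma dotZl n a (c x : 'rV[R]_n) : dot (a *: c) x = a * dot c x.
Proof. by rewrite /dot mulr_sumr; apply: eq_bigr => i _; rewrite mxE mulrA. Qed.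

Lemma dot0l n (x : 'rV[R]_n) : dot 0 x = 0.
Proof. by rewrite /dot big1 // => i _; rewrite mxE mul0r. Qed.

Lemma dotDr n (c x x' : 'rV[R]_n) : dot c (x + x') = dot c x + dot c x'.
Proof. by rewrite /dot -big_split; apply: eq_bigr => i _; rewrite mxE mulrDr. Qed.

Lemma dotZr n a (c x : 'rV[R]_n) : dot c (a *: x) = a * dot c x.
Proof. by rewrite /dot mulr_sumr; apply: eq_bigr => i _; rewrite mxE mulrCA. Qed.

Lemma dot_sumr n (I : finType) (A : {pred I}) (f : I -> 'rV[R]_n) c :
  dot c (\sum_(i in A) f i) = \sum_(i in A) dot c (f i).
Proof.
elim/big_rec2: _ => [|i y x _ <-]; last by rewrite dotDr.
by rewrite /dot big1 // => i _; rewrite mxE mulr0.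
Qed.

Lemma affineD n (f g : 'rV[R]_n -> R) :
  affine f -> affine g -> affine (fun x => f x + g x).
Proof.
move=> [c [b fE]] [c' [b' gE]]; exists (c + c'), (b + b') => x.
by rewrite fE gE dotDl addrACA.
Qed.

Lemma affineZ n a (f : 'rV[R]_n -> R) : affine f -> affine (fun x => a * f x).
Proof.
by move=> [c [b fE]]; exists (a *: c), (a * b) => x; rewrite fE dotZl mulrDr.
Qed.

Lemma affine_cst n a : affine (fun _ : 'rV[R]_n => a).
Proof. by exists 0, a => x; rewrite dot0l addr0. Qed.

Lemma affine_coord n (i : 'I_n) : affine (fun x : 'rV[R]_n => x 0 i).
Proof.
exists (delta_mx 0 i), 0 => x; rewrite add0r /dot (bigD1 i) //= big1 => [|j ji].
  by rewrite !mxE !eqxx mul1r addr0.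
by rewrite mxE (negPf ji) andbF mul0r.
Qed.

Lemma affine_sum n (I : finType) (A : {pred I}) (f : I -> 'rV[R]_n -> R) :
  (forall i, affine (f i)) -> affine (fun x => \sum_(i in A) f i x).
Proof.
move=> aff_f; have: affine (fun x => \sum_(i <- index_enum I | i \in A) f i x).
  elim: (index_enum I) => [|i s IHs].
    by exists 0, 0 => x; rewrite big_nil dot0l addr0.
  case Ai: (i \in A).
    have [c [b E]] := affineD (aff_f i) IHs.
    by exists c, b => x; rewrite big_cons Ai E.
  have [c [b E]] := IHs.
  by exists c, b => x; rewrite big_cons Ai E.
by [].
Qed.

Lemma zero_set_face n (P : set 'rV[R]_n) f : affine f ->
  (forall x, P x -> 0 <= f x) -> is_face P [set x | P x /\ f x = 0].
Proof.
move=> [c [b fE]] f_ge0; exists (- c), b.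
have dotN (x : 'rV[R]_n) : \sum_i (- c) 0 i * x 0 i = - dot c x.
  by rewrite /dot -sumrN; apply: eq_bigr => i _; rewrite mxE mulNr.
split=> [x /f_ge0|]; first by rewrite fE dotN; lra.
by rewrite predeqE => x; rewrite /= dotN fE; split=> -[Px e]; split=> //; lra.
Qed.

Lemma set0_face n (P : set 'rV[R]_n) : is_face P set0.
Proof.
have := @zero_set_face _ P (fun=> 1) (affine_cst _ 1) (fun _ _ => ler01).
rewrite (_ : [set x | _] = set0) // predeqE => x /=; split=> // -[_ /eqP].
by rewrite oner_eq0.
Qed.

Definition disjoint_pair d (U D : {set 'I_d}) := forall m, m \in U -> m \notin D.

(* The pairs [L m], [G m] play the part of the opposite facets of a cube. *)
Definition cube_data d n (P : set 'rV[R]_n) (L G : 'I_d -> 'rV[R]_n -> R) :=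
  [/\ forall m, affine (L m) /\ affine (G m),
      forall x m, P x -> 0 <= L m x /\ 0 <= G m x,
      forall A : {set 'I_d}, exists x, P x /\
        forall m, (L m x == 0) = (m \in A) /\ (G m x == 0) = (m \notin A) &
      forall c, exists K (l g : 'I_d -> R),
        (forall m, [/\ 0 <= l m, 0 <= g m & l m * g m = 0]) /\
        forall x, P x -> dot c x = K - \sum_m (l m * L m x + g m * G m x)].

Definition cube_face d n (P : set 'rV[R]_n) (L G : 'I_d -> 'rV[R]_n -> R)
    (U D : {set 'I_d}) : set 'rV[R]_n :=
  [set x | P x /\
     forall m, (m \in U -> L m x = 0) /\ (m \in D -> G m x = 0)].

Section Data.
Variables (d n : nat) (P : set 'rV[R]_n) (L G : 'I_d -> 'rV[R]_n -> R).
Hypothesis data : cube_data P L G.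
Implicit Types (U D : {set 'I_d}).

(** The sum of the chosen facet functions is nonnegative and vanishes only where all of them do. *)
Lemma cube_face_is_face U D : is_face P (cube_face P L G U D).
Proof.
have [aff ge0 _ _] := data.
pose f x := \sum_(m in U) L m x + \sum_(m in D) G m x.
have aff_f : affine f by apply: affineD; apply: affine_sum => m; case: (aff m).
have f_ge0 x : P x -> 0 <= f x.
  by move=> Px; rewrite addr_ge0 // sumr_ge0 // => m _; case: (ge0 x m Px).
have := zero_set_face aff_f f_ge0; congr is_face; rewrite predeqE => x /=.
split=> -[Px]; last first.
  by move=> z; split=> //; rewrite /f !big1 ?addr0 // => m mA; case: (z m); auto.
have sU : 0 <= \sum_(m in U) L m x by rewrite sumr_ge0 // => m _; case: (ge0 x m Px).
have sD : 0 <= \sum_(m in D) G m x by rewrite sumr_ge0 // => m _; case: (ge0 x m Px).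
move/eqP; rewrite paddr_eq0 // => /andP[/eqP zU /eqP zD]; split=> // m.
split=> mA.
  by apply: (psumr_eq0P _ zU) => // i _; case: (ge0 x i Px).
by apply: (psumr_eq0P _ zD) => // i _; case: (ge0 x i Px).
Qed.

(** Two test vertices suffice: at one the vanishing L m are exactly those with m in U, at the other
    the vanishing G m are exactly those with m in D. *)
Lemma cube_face_sub U D U' D' : disjoint_pair U D ->
  cube_face P L G U D `<=` cube_face P L G U' D' <-> U' \subset U /\ D' \subset D.
Proof.
have [_ _ vtx _] := data; move=> dUD; split=> [sub|[sU sD]]; last first.
  by move=> x [Px z]; split=> // m; split=> /(fintype.subsetP _ m) mA;
    case: (z m); auto.
have dis m : m \in U -> m \notin D by exact: dUD.
split; apply/fintype.subsetP=> m mA.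
  have [x [Px z]] := vtx U; have [_ /(_ m)[/(_ mA)/eqP]] : cube_face P L G U' D' x.
    apply: sub; split=> // i; split=> iA; apply/eqP; first by rewrite (z i).1.
    by rewrite (z i).2; apply: contraL iA => /dis.
  by rewrite (z m).1.
have [x [Px z]] := vtx (~: D); have [_ /(_ m)[_ /(_ mA)/eqP]] : cube_face P L G U' D' x.
  apply: sub; split=> // i; split=> iA; apply/eqP; last by rewrite (z i).2 inE negbK.
  by rewrite (z i).1 inE dis.
by rewrite (z m).2 inE negbK.
Qed.

Lemma cube_face_neq0 U D : disjoint_pair U D -> cube_face P L G U D !=set0.
Proof.
have [_ _ vtx _] := data; move=> dUD; have [x [Px z]] := vtx U.
exists x; split=> // m; split=> mA; apply/eqP; first by rewrite (z m).1.
by rewrite (z m).2; apply: contraL mA => /dUD.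
Qed.

(* A functional written as [K] minus a nonnegative combination, with at most one
   facet of each opposite pair, is maximal where the facets used vanish. *)
Lemma face_cube_face F : is_face P F ->
  F = set0 \/ exists U D, disjoint_pair U D /\ F = cube_face P L G U D.
Proof.
have [_ ge0 vtx decomp] := data; move=> [c [b [valid ->]]].
have [->|/set0P[x0 [Px0 cx0]]] :=
  eqVneq [set x | P x /\ \sum_i c 0 i * x 0 i = b] set0; first by left.
right; have [K [l [g [pos cE]]]] := decomp c.
pose U := [set m | l m != 0]%SET; pose D := [set m | g m != 0]%SET.
have dUD : disjoint_pair U D.
  move=> m; rewrite !inE negbK => lm.
  by have [_ _ /eqP] := pos m; rewrite mulf_eq0 (negPf lm).
have t_ge0 x m : P x -> 0 <= l m * L m x + g m * G m x.
  by move=> Px; have [? ? _] := pos m; have [? ?] := ge0 x m Px;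
     rewrite addr_ge0 ?mulr_ge0.
have [y [Py zy]] := cube_face_neq0 dUD.
have cy : dot c y = K.
  rewrite cE // big1 ?subr0 // => m _; have [zL zG] := zy m.
  have [l0|l0] := eqVneq (l m) 0; have [g0|g0] := eqVneq (g m) 0.
  - by rewrite l0 g0 !mul0r addr0.
  - by rewrite l0 zG ?inE // mul0r mulr0 addr0.
  - by rewrite g0 zL ?inE // mul0r mulr0 addr0.
  - by rewrite zL ?zG ?inE // !mulr0 addr0.
have bK : b = K.
  apply/eqP; rewrite eq_le -{1}cx0 -cy -/(dot c x0) valid // andbT cy cE //.
  by rewrite gerBl sumr_ge0 // => m _; apply: t_ge0.
exists U, D; split=> //; rewrite predeqE => x /=; split=> -[Px].
  rewrite -/(dot c x) cE // bK => /eqP.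
  rewrite subr_eq addrC -subr_eq subrr eq_sym psumr_eq0 => [|m _]; last exact: t_ge0.
  move/allP=> z; split=> // m; have := z m; rewrite mem_index_enum => /(_ isT) /=.
  have [? ? _] := pos m; have [? ?] := ge0 x m Px.
  rewrite paddr_eq0 ?mulr_ge0 // !mulf_eq0 !inE => /andP[zl zg].
  split=> nz; apply/eqP; first by rewrite (negPf nz) in zl.
  by rewrite (negPf nz) in zg.
move=> z; split=> //; rewrite -/(dot c x) cE // bK big1 ?subr0 // => m _.
have [zL zG] := z m.
have [l0|l0] := eqVneq (l m) 0; have [g0|g0] := eqVneq (g m) 0.
- by rewrite l0 g0 !mul0r addr0.
- by rewrite l0 zG ?inE // mul0r mulr0 addr0.
- by rewrite g0 zL ?inE // mul0r mulr0 addr0.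
- by rewrite zL ?zG ?inE // !mulr0 addr0.
Qed.

End Data.

Section Equiv.
Variables (d n n' : nat).
Variables (P : set 'rV[R]_n) (L G : 'I_d -> 'rV[R]_n -> R).
Variables (P' : set 'rV[R]_n') (L' G' : 'I_d -> 'rV[R]_n' -> R).
Hypotheses (data : cube_data P L G) (data' : cube_data P' L' G').

(** Intersects the facets of P' that correspond to the facets containing F. The nonemptiness clause
    matters for d = 0, where the empty face would otherwise go to P'. *)
Let transfer (F : set 'rV[R]_n) : set 'rV[R]_n' :=
  [set y | [/\ F !=set0, P' y &
     forall m, (F `<=` [set x | L m x = 0] -> L' m y = 0) /\
               (F `<=` [set x | G m x = 0] -> G' m y = 0)]].

Let transfer0 : transfer set0 = set0.
Proof. by rewrite predeqE => y; split=> // -[[]]. Qed.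

Let transfer_face (U D : {set 'I_d}) : disjoint_pair U D ->
  transfer (cube_face P L G U D) = cube_face P' L' G' U D.
Proof.
move=> dUD; have ne := cube_face_neq0 data dUD; rewrite predeqE => y; split.
  move=> [_ Py z]; split=> // m; split=> mA; have [zL zG] := z m.
    by apply: zL => x [_ /(_ m)[+ _]]; apply.
  by apply: zG => x [_ /(_ m)[_ +]]; apply.
move=> [Py z]; split=> // m; split=> sub; have [zL zG] := z m.
  apply: zL; have : cube_face P L G U D `<=` cube_face P L G [set m]%SET finset.set0.
    move=> x Fx; split=> [|i]; first by case: Fx.
    by rewrite !inE; split=> // /eqP ->; apply: sub.
  by case/(cube_face_sub data _ _ dUD) => /fintype.subsetP/(_ m) + _; rewrite inE eqxx;
    apply.
apply: zG; have : cube_face P L G U D `<=` cube_face P L G finset.set0 [set m]%SET.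
  move=> x Fx; split=> [|i]; first by case: Fx.
  by rewrite !inE; split=> // /eqP ->; apply: sub.
by case/(cube_face_sub data _ _ dUD) => _ /fintype.subsetP/(_ m); rewrite inE eqxx; apply.
Qed.

Lemma cube_data_equiv : comb_equiv P P'.
Proof.
have mono F H : faces P F -> faces P H ->
    (F `<=` H <-> transfer F `<=` transfer H).
  move=> /(face_cube_face data)[->|[U [D [dUD ->]]]].
    by rewrite transfer0; split=> _; exact: sub0set.
  move=> /(face_cube_face data)[->|[U' [D' [dUD' ->]]]].
    rewrite transfer0 transfer_face // !subset0.
    have /set0P/eqP ? := cube_face_neq0 data dUD.
    by have /set0P/eqP ? := cube_face_neq0 data' dUD.
  by rewrite !transfer_face // (cube_face_sub data _ _ dUD) (cube_face_sub data' _ _ dUD).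
exists transfer; split=> //; split.
- move=> F /(face_cube_face data)[->|[U [D [dUD ->]]]].
    by rewrite transfer0; exact: set0_face.
  by rewrite transfer_face //; exact: (cube_face_is_face data').
- move=> F H /set_mem FF /set_mem HH eqFH; apply/seteqP; split.
    by apply/mono => //; rewrite eqFH.
  by apply/mono => //; rewrite eqFH.
move=> F /(face_cube_face data')[->|[U [D [dUD ->]]]].
  by exists set0; [exact: set0_face | exact: transfer0].
by exists (cube_face P L G U D); [exact: (cube_face_is_face data) | exact: transfer_face].
Qed.

End Equiv.

Lemma cube_cube_data d :
  cube_data (cube R d) (fun m x => 1 - x 0 m) (fun m x => x 0 m).
Proof.
split.
- move=> m; split; last exact: affine_coord.
  have [c [b E]] := affineD (affine_cst _ 1) (affineZ (- 1) (affine_coord m)).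
  by exists c, b => x; rewrite -E mulN1r.
- by move=> x m /(_ m)/andP[? ?]; rewrite subr_ge0.
- move=> A; exists (\row_m (m \in A)%:R); split=> [m|m]; rewrite mxE.
    by case: (m \in A); rewrite ?ler01 ?lexx.
  by case: (m \in A); rewrite ?subrr ?subr0 ?eqxx ?oner_eq0.
move=> c; pose l m := Num.max (c 0 m) 0; pose g m := Num.max (- c 0 m) 0.
exists (\sum_m l m), l, g; split=> [m|x Px].
  rewrite /l /g; case: (lerP (c 0 m) 0) => c0; rewrite ?le_max ?lexx ?orbT.
    by split=> //; rewrite mul0r.
  by split; [exact: ltW | by [] | rewrite max_r ?mulr0 // oppr_le0 ltW].
rewrite -sumrB; apply: eq_bigr => m _; rewrite /l /g.
case: (lerP (c 0 m) 0) => c0; first by rewrite max_l ?oppr_ge0 //; ring.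
by rewrite max_r ?oppr_le0 ?ltW //; ring.
Qed.

End CubeLike.

(** * Edges at a vertex of a combinatorial cube *)

Section Edges.
Local Open Scope ring_scope.
Local Open Scope classical_set_scope.
Variable R : realType.

Definition segment n (x y : 'rV[R]_n) : set 'rV[R]_n :=
  [set p | exists t, 0 <= t <= 1 /\ p = x + t *: (y - x)].

Section Transfer.
Variables (d n n' N : nat).
Variables (P : set 'rV[R]_n) (P' : set 'rV[R]_n').
Variables (L G : 'I_d -> 'rV[R]_n' -> R).
Hypotheses (data : cube_data P' L G) (equiv : comb_equiv P P').
Variables (w0 : 'rV[R]_n) (z : 'I_N -> 'rV[R]_n).
Hypothesis face_w0 : is_face P [set w0].
Hypothesis face_z : forall e, is_face P (segment w0 (z e)).
Hypothesis neq_z : forall e, z e <> w0.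
Hypothesis notin_z : forall e e', e <> e' -> ~ segment w0 (z e) (z e').

Let seg_w0 e : segment w0 (z e) w0.
Proof. by exists 0; rewrite lexx ler01 scale0r addr0. Qed.

Let seg_z e : segment w0 (z e) (z e).
Proof. by exists 1; rewrite lexx ler01 scale1r addrC subrK. Qed.

Let seg_sub e F : is_face P F -> F w0 -> F (z e) -> segment w0 (z e) `<=` F.
Proof.
move=> [c [b [_ ->]]] [Pw cw] [Pz cz] x xs; split.
  by have [c' [b' [_ E]]] := face_z e; move: xs; rewrite E => -[].
case: xs => t [_ ->]; rewrite -/(dot c _) dotDr dotZr dotDr.
have -> : dot c (- w0) = - dot c w0 by rewrite -scaleN1r dotZr mulN1r.
by rewrite -/(dot c w0) -/(dot c (z e)) in cw cz *; rewrite cw cz; ring.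
Qed.

Let seg_min e F : is_face P F -> F w0 -> F `<=` segment w0 (z e) ->
  F = [set w0] \/ F = segment w0 (z e).
Proof.
move=> faceF Fw sub; have [Fz|nFz] := pselect (F (z e)).
  by right; apply/seteqP; split=> //; apply: seg_sub.
left; apply/seteqP; split=> x /=; last by move->.
move=> Fx; have [t [_ def_x]] := sub x Fx.
have [Px Pz] : P x /\ P (z e).
  split; first by case: faceF Fx => c [b [_ ->]] [].
  by have [c' [b' [_ E]]] := face_z e; have := seg_z e; rewrite E => -[].
have [c [b [valid E]]] := faceF; rewrite E in Fx Fw nFz.
case: Fx Fw => _ cx [_ cw]; rewrite -/(dot c x) -/(dot c w0) in cx cw.
have cz : dot c (z e) <> b by move=> cz; apply: nFz.
move: cx; rewrite def_x dotDr dotZr dotDr.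
have -> : dot c (- w0) = - dot c w0 by rewrite -scaleN1r dotZr mulN1r.
rewrite cw => cx; have /eqP : t * (dot c (z e) - b) = 0 by lra.
rewrite mulf_eq0 subr_eq0.
by case/orP=> [/eqP ->|/eqP //]; rewrite scale0r addr0.
Qed.

(** In the cube, the vertex fixes one facet of each opposite pair, and an edge at it frees one pair
    m. The facet of the pair m through the vertex contains all the other edges there, but not this
    one. *)
Lemma edge_opposite_face e : exists F, [/\ is_face P F, F w0,
  forall e', e' <> e -> F (z e') & ~ F (z e)].
Proof.
have [f [[f_faces f_inj f_surj] f_mono]] := equiv.
have onto F' : is_face P' F' -> exists2 F, is_face P F & f F = F'.
  by move=> /f_surj[F FF <-]; exists F.
have f0 : f set0 = set0.
  have [F FF fF] := onto _ (set0_face P'); rewrite -subset0 -fF.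
  by apply/f_mono => //; exact: set0_face.
have w0_sub F : F w0 <-> [set w0] `<=` F.
  by split=> [Fw x /= -> //|]; apply.
have [U fw0] : exists U : {set 'I_d}, f [set w0] = cube_face P' L G U (~: U)%SET.
  have /(face_cube_face data)[fw0|[U [D [dUD fw0]]]] := f_faces _ face_w0.
    have : [set w0] `<=` set0.
      by apply/f_mono; rewrite ?fw0 ?f0 //; exact: set0_face.
    by move/(_ w0 erefl).
  (* The smaller face with [~: U] in place of D is nonempty and comes from a face inside {w0}, hence
     from {w0} itself. *)
  exists U; have dUU : disjoint_pair U (~: U)%SET by move=> m; rewrite inE negbK.
  have [F FF fF] := onto _ (cube_face_is_face data U (~: U)%SET); rewrite -fF; congr f.
  have sF : F `<=` [set w0].
    apply/f_mono => //; rewrite fF fw0 (cube_face_sub data _ _ dUU); split=> //.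
    by apply/fintype.subsetP => m mD; rewrite inE; apply: contraL mD => /dUD.
  apply/seteqP; split=> //; rewrite -w0_sub.
  have [F0|/set0P[x Fx]] := eqVneq F set0; last by rewrite -(sF x Fx).
  by have := cube_face_neq0 data dUU; rewrite -fF F0 f0 => -[].
pose E m := cube_face P' L G (U :\ m)%SET (~: U :\ m)%SET.
have dE m : disjoint_pair (U :\ m)%SET (~: U :\ m)%SET.
  by move=> i; rewrite !inE => /andP[_ ->]; rewrite andbF.
have dUU : disjoint_pair U (~: U)%SET by move=> m; rewrite inE negbK.
have f_edge e1 : exists m, f (segment w0 (z e1)) = E m.
  have sw : f [set w0] `<=` f (segment w0 (z e1)).
    by apply/f_mono; try exact: face_z; move=> // x ->; exact: seg_w0.
  have nsw : ~ f (segment w0 (z e1)) `<=` f [set w0].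
    move/f_mono => /(_ (face_z e1) face_w0)/(_ (z e1) (seg_z e1)) /=.
    exact: neq_z.
  have /(face_cube_face data)[fz|[U1 [D1 [d1 fz]]]] := f_faces _ (face_z e1).
    by case: nsw; rewrite fz.
  move: sw nsw; rewrite fw0 fz (cube_face_sub data _ _ dUU) (cube_face_sub data _ _ d1).
  move=> [sU sD] nsub.
  (* The image of the edge is larger than that of the vertex, so it leaves some pair m free. It
     contains [E m], which is also larger than the vertex, and [seg_min] makes them equal. *)
  have [m mU mD] : exists2 m, m \notin U1 & m \notin D1.
    apply: contrapT => no_m; apply: nsub; split; apply/fintype.subsetP => m mU.
      apply: contrapT => /negP mU1; apply: no_m; exists m => //.
      by apply: contraL mU => /(fintype.subsetP sD); rewrite inE.
    apply: contrapT => /negP mD1; apply: no_m; exists m => //.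
    by move: mU; rewrite inE; apply: contra => /(fintype.subsetP sU).
  exists m; have [F FF fF] := onto _ (cube_face_is_face data (U :\ m)%SET (~: U :\ m)%SET).
  have Fw : F w0.
    suff : [set w0] `<=` F by apply.
    apply/f_mono => //; rewrite fF fw0 (cube_face_sub data _ _ dUU).
    by split; exact: subD1set.
  have sF : F `<=` segment w0 (z e1).
    apply/f_mono => //; first exact: face_z.
    rewrite fF fz (cube_face_sub data _ _ (@dE m)).
    by rewrite !subsetD1 sU sD mU mD.
  have [F1|F1] := seg_min FF Fw sF; last by rewrite -fz -F1.
  have : E m `<=` f [set w0] by rewrite -F1 fF.
  rewrite fw0 (cube_face_sub data _ _ (@dE m)) =>
    -[/fintype.subsetP s1 /fintype.subsetP s2].
  have := s1 m; have := s2 m; rewrite !inE eqxx /=.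
  by case: (m \in U) => [_ /(_ isT)|/(_ isT)].
have [m fm] := f_edge e.
have [F FF fF] := onto _ (cube_face_is_face data (U :&: [set m]) (~: U :&: [set m]))%SET.
exists F; have Fw : F w0.
  suff : [set w0] `<=` F by apply.
  apply/f_mono => //; rewrite fF fw0 (cube_face_sub data _ _ dUU).
  by split; exact: subsetIl.
split=> // [e' ne|Fz].
  have [m' fm'] := f_edge e'.
  have nm : m != m'.
    apply/eqP => mm; have eqs : segment w0 (z e) = segment w0 (z e').
      by apply: f_inj; rewrite ?inE //=; [exact: face_z|exact: face_z|rewrite fm fm' mm].
    by apply: (notin_z (not_eq_sym ne)); rewrite eqs.
  have : segment w0 (z e') `<=` F; last by apply.
  apply/f_mono => //; first exact: face_z.
  rewrite fF fm' (cube_face_sub data _ _ (@dE m')).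
  by split; apply/fintype.subsetP => i; rewrite !inE => /andP[-> /eqP ->]; rewrite nm.
have : segment w0 (z e) `<=` F by exact: seg_sub.
move/f_mono => /(_ (face_z e) FF); rewrite fF fm (cube_face_sub data _ _ (@dE m)).
move=> [/fintype.subsetP s1 /fintype.subsetP s2].
have := s1 m; have := s2 m; rewrite !inE eqxx /=.
by case: (m \in U) => [_ /(_ isT)|/(_ isT)].
Qed.

(* The faces opposite to the edges at a vertex form a dual basis. *)
Lemma edges_row_free : row_free (\matrix_(e < N) (z e - w0)).
Proof.
have dual e : exists c : 'rV[R]_n,
    forall e', dot c (z e' - w0) = (e == e')%:R.
  have [F [[c [b [_ ->]]] [Pw cw] on_F off_F]] := edge_opposite_face e.
  have cB x : dot c (x - w0) = dot c x - b.
    by rewrite dotDr -cw; congr (_ + _); rewrite -scaleN1r dotZr mulN1r.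
  have Pz : P (z e).
    by have [c' [b' [_ E]]] := face_z e; have := seg_z e; rewrite E => -[].
  have nz : dot c (z e) - b != 0.
    by rewrite subr_eq0; apply/eqP => cz; apply: off_F.
  exists ((dot c (z e) - b)^-1 *: c) => e'; rewrite dotZl cB.
  case: eqVneq => [<-|/eqP ne]; first by rewrite mulVf.
  by have [_ cz] := on_F e' (not_eq_sym ne); rewrite /dot cz subrr mulr0.
have {dual} [c cE] := choice dual.
apply/row_freeP; exists (\matrix_(i < n, e < N) c e 0 i).
apply/matrixP => e' e; rewrite !mxE eq_sym -cE /dot.
by apply: eq_bigr => i _; rewrite !mxE mulrC.
Qed.

End Transfer.

Lemma sum0_not_row_free n (A : 'M[R]_n) : (0 < n)%N ->
  (forall e, \sum_i A e i = 0) -> ~~ row_free A.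
Proof.
case: n A => // n A _ sum0; apply/negP; rewrite row_free_unit => unitA.
have : A *m const_mx 1 = 0 :> 'cV_n.+1.
  apply/matrixP => e j; rewrite !mxE -[RHS](sum0 e).
  by apply: eq_bigr => i _; rewrite mxE mulr1.
move/(congr1 (mulmx (invmx A))); rewrite mulKmx // mulmx0.
by move/matrixP/(_ 0 0)/eqP; rewrite !mxE oner_eq0.
Qed.

End Edges.

(** * Elimination in triangular systems of bounds *)

Section Triangular.
Local Open Scope ring_scope.
Variable R : realType.

Variables (d : nat) (T : Type) (P : T -> Prop) (X L G : 'I_d -> T -> R).
Variables (ord : 'I_d -> nat) (a b : 'I_d -> 'I_d -> R) (cL cG : 'I_d -> R).
Hypothesis a_ord : forall m i, a m i != 0 -> (ord i < ord m)%N.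
Hypothesis b_ord : forall m i, b m i != 0 -> (ord i < ord m)%N.
Hypothesis LE : forall m x, P x -> L m x = cL m + \sum_i a m i * X i x - X m x.
Hypothesis GE : forall m x, P x -> G m x = cG m - \sum_i b m i * X i x + X m x.

(** Coordinates are eliminated from the last one in [ord] backwards. A positive coefficient of X m
    is traded for a multiple of L m, a negative one for a multiple of G m; this changes only the
    coefficients of earlier coordinates. *)
Lemma triangular_decomp (c : 'I_d -> R) : exists K (l g : 'I_d -> R),
  (forall m, [/\ 0 <= l m, 0 <= g m & l m * g m = 0]) /\
  forall x, P x -> \sum_m c m * X m x = K - \sum_m (l m * L m x + g m * G m x).
Proof.
have [N cN] : exists N, forall m, c m != 0 -> (ord m < N)%N.
  by exists (\max_m ord m).+1 => m _; rewrite ltnS leq_bigmax.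
(* The last clause keeps the multipliers of different levels on disjoint supports, so that
   [l m * g m = 0] survives when they are added. *)
suff [K [l [g [pos E _]]]] : exists K (l g : 'I_d -> R),
    [/\ forall m, [/\ 0 <= l m, 0 <= g m & l m * g m = 0],
        forall x, P x ->
          \sum_m c m * X m x = K - \sum_m (l m * L m x + g m * G m x) &
        forall m, (N <= ord m)%N -> l m = 0 /\ g m = 0].
  by exists K, l, g.
elim: N c cN => [|N IHN] c cN.
  exists 0, (fun=> 0), (fun=> 0); split=> // [m|x Px]; first by rewrite mul0r.
  rewrite !big1 ?subr0 // => m _; first by rewrite !mul0r addr0.
  by have [->|/cN] := eqVneq (c m) 0; rewrite ?mul0r.
pose l1 m := if ord m == N then Num.max (c m) 0 else 0.
pose g1 m := if ord m == N then Num.max (- c m) 0 else 0.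
pose c1 i := (if ord i == N then 0 else c i) +
  \sum_m l1 m * a m i - \sum_m g1 m * b m i.
have l1_ge0 m : 0 <= l1 m by rewrite /l1; case: ifP => // _; rewrite le_max lexx orbT.
have g1_ge0 m : 0 <= g1 m by rewrite /g1; case: ifP => // _; rewrite le_max lexx orbT.
have l1g1 m : l1 m * g1 m = 0 /\ l1 m - g1 m = if ord m == N then c m else 0.
  rewrite /l1 /g1; case: ifP => _; last by rewrite mul0r subr0.
  case: (lerP (c m) 0) => c0; first by rewrite mul0r max_l ?oppr_ge0 ?sub0r ?opprK.
  by rewrite max_r ?mulr0 ?subr0 // oppr_le0 ltW.
have ord1 m : l1 m != 0 \/ g1 m != 0 -> ord m = N.
  by rewrite /l1 /g1; case: (eqVneq (ord m) N) => // _ []; rewrite eqxx.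
have c1N m : c1 m != 0 -> (ord m < N)%N.
  apply: contraR; rewrite -leqNgt => le_N; rewrite /c1.
  rewrite [\sum_(i < d) l1 _ * _]big1 => [|i _]; last first.
    apply/eqP; rewrite mulf_eq0; apply: contraT; rewrite negb_or => /andP[l0 /a_ord].
    by rewrite (ord1 i (or_introl l0)) ltnNge le_N.
  rewrite [\sum_(i < d) g1 _ * _]big1 => [|i _]; last first.
    apply/eqP; rewrite mulf_eq0; apply: contraT; rewrite negb_or => /andP[l0 /b_ord].
    by rewrite (ord1 i (or_intror l0)) ltnNge le_N.
  rewrite addr0 subr0; have [_|neq] := eqVneq (ord m) N; first by rewrite eqxx.
  apply: contraT => /cN.
  by move: neq le_N; lia.
have [K [l [g [pos E supp]]]] := IHN c1 c1N.
exists (K - \sum_m (- (l1 m * cL m) - g1 m * cG m)),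
  (fun m => l m + l1 m), (fun m => g m + g1 m); split=> [m|x Px|m le_m].
- have [l0 g0 lg] := pos m; split; [exact: addr_ge0 | exact: addr_ge0 |].
  have [e|ne] := eqVneq (ord m) N.
    have le_N : (N <= ord m)%N by rewrite e.
    by have [-> ->] := supp m le_N; rewrite !add0r (l1g1 m).1.
  by rewrite /l1 /g1 (negPf ne) !addr0.
- have eq_c1 : \sum_m c1 m * X m x = \sum_m c m * X m x +
      \sum_m (l1 m * (\sum_i a m i * X i x - X m x) +
              g1 m * (- (\sum_i b m i * X i x) + X m x)).
    have swap (f : 'I_d -> R) (e : 'I_d -> 'I_d -> R) :
        \sum_i (\sum_m f m * e m i) * X i x = \sum_m f m * \sum_i e m i * X i x.
      under eq_bigr => i _ do rewrite mulr_suml.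
      rewrite exchange_big; apply: eq_bigr => m _ /=; rewrite mulr_sumr.
      by apply: eq_bigr => i _; rewrite mulrA.
    under eq_bigr => m _ do rewrite /c1 mulrBl mulrDl.
    rewrite sumrB big_split /= !swap -addrA -sumrB -!big_split /=.
    apply: eq_bigr => m _; have [_] := l1g1 m.
    by case: ifP => _ e; [have -> : c m = l1 m - g1 m by [] | have -> : l1 m = g1 m by lra];
      ring.
  have {eq_c1} -> : \sum_m c m * X m x = \sum_m c1 m * X m x -
      \sum_m (l1 m * (\sum_i a m i * X i x - X m x) +
              g1 m * (- (\sum_i b m i * X i x) + X m x)) by rewrite eq_c1 addrK.
  rewrite E // -!addrA -!opprD -!big_split /=; congr (K - _).
  by apply: eq_bigr => m _; rewrite LE // GE //; ring.
have [-> ->] := supp m (ltnW le_m).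
by rewrite /l1 /g1 gtn_eqF // addr0.
Qed.

End Triangular.

(** * Prefix sums as coordinates *)

Section PrefixSums.
Local Open Scope ring_scope.
Variables (R : realType) (n : nat).
Implicit Types (x c : 'rV[R]_n).

Definition psum t x : R := \sum_(i < n | (i < t)%N) x 0 i.

Lemma affine_psum t : affine (psum t).
Proof.
have [c [b E]] := affine_sum [pred i : 'I_n | (i < t)%N] (@affine_coord R n).
by exists c, b => x; rewrite -E.
Qed.

Lemma psum0 x : psum 0 x = 0.
Proof. by rewrite /psum big_pred0. Qed.

Lemma psumS (i : 'I_n) x : psum i.+1 x = psum i x + x 0 i.
Proof.
rewrite /psum (bigD1 i) //= addrC; congr (_ + _); apply: eq_bigl => j.
by rewrite ltnS ltn_neqAle andbC.
Qed.

Lemma psum_index N t x : (0 < n)%N -> (t <= n)%N -> psum n x = N ->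
  psum t x = (t == n)%:R * N +
    \sum_(i < n.-1) (i.+1 == t)%:R * psum i.+1 x.
Proof.
move=> n0 tn xN; case: t tn => [|t] tn.
  by rewrite psum0 ltn_eqF // mul0r add0r big1 // => i _; rewrite mul0r.
have [->|neq] := eqVneq t.+1 n.
  rewrite mul1r xN big1 ?addr0 // => i _; rewrite ltn_eqF ?mul0r //.
  by have := ltn_ord i; lia.
have lt_t : (t < n.-1)%N by lia.
rewrite mul0r add0r (bigD1 (Ordinal lt_t)) //= eqxx mul1r big1 ?addr0 // => i.
by rewrite -val_eqE /= eqSS => /negPf ->; rewrite mul0r.
Qed.

(** Abel summation. *)
Lemma dot_psum c : (0 < n)%N -> exists (e : 'I_n.-1 -> R) e0, forall x,
  dot c x = e0 * psum n x + \sum_i e i * psum i.+1 x.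
Proof.
move=> n0; pose C (i : nat) := if insub i is Some j then c 0 j else 0.
exists (fun i => C i - C i.+1), (C n.-1) => x.
have -> : dot c x = \sum_(i < n) (C i * psum i.+1 x - C i * psum i x).
  apply: eq_bigr => i _; rewrite psumS /C valK; ring.
rewrite sumrB; have nE : n.-1.+1 = n by rewrite prednK.
have recr (F : nat -> R) : \sum_(i < n) F i = \sum_(i < n.-1) F i + F n.-1.
  by rewrite -!(big_mkord xpredT F) -{1}nE big_nat_recr.
have recl (F : nat -> R) : \sum_(i < n) F i = F 0%N + \sum_(i < n.-1) F i.+1.
  rewrite -(big_mkord xpredT F) -(big_mkord xpredT (fun i => F i.+1)).
  by rewrite -{1}nE big_nat_recl.
rewrite (recr (fun i => C i * psum i.+1 x)) (recl (fun i => C i * psum i x)).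
rewrite psum0 mulr0 add0r nE addrAC -sumrB addrC; congr (_ + _).
by apply: eq_bigr => i _; rewrite mulrBl.
Qed.

End PrefixSums.

(** * Functionals maximal at w *)

Lemma leq_sum_eq (I : finType) (E1 E2 : I -> nat) :
  (forall i, E1 i <= E2 i) -> \sum_i E1 i = \sum_i E2 i ->
  forall i, E1 i = E2 i.
Proof.
move=> le_E eq_E i; apply/eqP; rewrite eqn_leq le_E /=.
have : \sum_(j | j != i) E1 j <= \sum_(j | j != i) E2 j.
  by apply: leq_sum => j _; apply: le_E.
by move: eq_E; rewrite (bigD1 i) //= [RHS](bigD1 i) //=; lia.
Qed.

Lemma sum_leq_ord a T : a <= T -> \sum_(t < T) (t < a) = a.
Proof.
elim: T => [|T IHT]; first by rewrite big_ord0; case: a.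
rewrite leq_eqVlt => /orP[/eqP ->|aT].
  rewrite (eq_bigr (fun=> 1)) ?sum1_card ?card_ord // => t _.
  by rewrite ltn_ord.
by rewrite big_ord_recr /= IHT // ltnNge -ltnS aT addn0.
Qed.

Section Keys.
Variable n : nat.
Implicit Types (z w : 'S_n) (i j p : 'I_n) (key : 'I_n -> nat).

Lemma rk_ord z m q : m <= n ->
  rk z m q = \sum_(p < n) ((p < m) && (q <= z p)).
Proof.
move=> le_m; rewrite /rk (big_ord_widen n (fun r : nat => (q <= pv z r) : nat) le_m).
by rewrite big_mkcond; apply: eq_bigr => p _; rewrite pvE; case: ifP.
Qed.

Definition cnt key z t q := \sum_(p < n) ((t <= key p) && (q <= z p)).

(* An upper set [S] of positions for the inversions of [w] contains all
   positions of large value before its last position of small value. *)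
Lemma cnt_le key z w t q :
  (forall p p', p < p' -> w p' < w p -> key p' <= key p) -> ble z w ->
  cnt key z t q <= cnt key w t q.
Proof.
move=> mono zw.
have [[m0 Tm0]|noT] := pselect (exists m, (t <= key m) && (w m < q)); last first.
  apply: leq_sum => p _; have [tp|//] := leqP t (key p).
  suff -> : q <= w p by rewrite leq_b1.
  by rewrite leqNgt; apply/negP => lt_q; apply: noT; exists p; rewrite tp.
case: (@arg_maxnP _ m0 (fun m => (t <= key m) && (w m < q)) (fun m => m) Tm0).
move=> m /andP[tm mq] max_m.
have := zw m.+1 q; rewrite !rk_ord //= => le_rk.
have splitS u : cnt key u t q =
    \sum_(p < n) [&& p <= m, t <= key p & q <= u p] +
    \sum_(p < n) [&& m < p, t <= key p & q <= u p].
  rewrite -big_split; apply: eq_bigr => p _ /=.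
  by case: (leqP p m) => _; rewrite ?addn0.
rewrite !splitS leq_add //.
  apply: (@leq_trans (\sum_(p < n) ((p < m.+1) && (q <= z p)))).
    apply: leq_sum => p _; rewrite ltnS.
    by case: (p <= m); case: (q <= z p); case: (t <= key p).
  apply: (leq_trans le_rk); apply: leq_sum => p _; rewrite ltnS.
  have [pm|//] := leqP p m; have [qp|//] := leqP q (w p).
  rewrite /= lt0b (leq_trans tm) //; move: pm; rewrite leq_eqVlt.
  case/orP=> [/eqP/val_inj -> //|pm]; apply: mono => //.
  exact: leq_trans mq qp.
apply: leq_sum => p _; have [//|mp] := leqP p m; have [tp|//] := leqP t (key p).
case: (leqP q (w p)) => [_|lt_q]; first by rewrite /= leq_b1.
by have := max_m p; rewrite tp lt_q => /(_ isT) /=; lia.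
Qed.

Lemma sum_key key z T : (forall p, key p <= T) ->
  \sum_p key p * z p = \sum_(t < T) \sum_(q < n) cnt key z t.+1 q.+1.
Proof.
move=> le_T; under [RHS]eq_bigr => t _ do rewrite exchange_big /=.
rewrite exchange_big; apply: eq_bigr => p _ /=.
rewrite -[key p in LHS](sum_leq_ord (le_T p)) big_distrl; apply: eq_bigr => t _ /=.
case: ltnP => _ /=; last by rewrite big1.
by rewrite mul1n sum_leq_ord // ltnW.
Qed.

(** Both sums are sums of the counts compared in [cnt_le], so equal sums force equal counts. The
    mixed second difference of the counts at (key p, w p) is the number of positions with exactly
    this key and value. *)
Lemma key_max key z w :
  (forall p p', p < p' -> w p' < w p -> key p' <= key p) -> ble z w ->
  \sum_p key p * z p <= \sum_p key p * w p /\
  (\sum_p key p * z p = \sum_p key p * w p ->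
   forall p, exists p', key p' = key p /\ z p' = w p).
Proof.
move=> mono zw; pose T := \max_p key p.
have le_T p : key p <= T by exact: leq_bigmax.
rewrite !(sum_key _ le_T); split.
  by apply: leq_sum => t _; apply: leq_sum => q _; apply: cnt_le.
move=> eq_sum.
have eq_cnt t q : cnt key z t q = cnt key w t q.
  case: t => [|t].
    rewrite /cnt (reindex_inj (@perm_inj _ z^-1%g)).
    rewrite [RHS](reindex_inj (@perm_inj _ w^-1%g)) /=.
    by apply: eq_bigr => p _; rewrite !permKV.
  case: q => [|q]; first by apply: eq_bigr => p _; rewrite !andbT.
  have [lt_t|ge_t] := ltnP t T; last first.
    rewrite /cnt !big1 // => p _; rewrite ltnNge (leq_trans (le_T p)) //.
  have [lt_q|ge_q] := ltnP q n; last first.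
    rewrite /cnt !big1 // => p _; rewrite [q < _]ltnNge (leq_trans _ ge_q) ?andbF //;
    exact: ltnW.
  have le_t (t' : 'I_T) : \sum_(r < n) cnt key z t'.+1 r.+1 <=
                          \sum_(r < n) cnt key w t'.+1 r.+1.
    by apply: leq_sum => r _; apply: cnt_le.
  have := leq_sum_eq le_t eq_sum (Ordinal lt_t) => /leq_sum_eq.
  by move/(_ _ (Ordinal lt_q)); apply=> r; apply: cnt_le.
move=> p.
have splitE u : cnt key u (key p) (w p) + cnt key u (key p).+1 (w p).+1 =
    cnt key u (key p).+1 (w p) + cnt key u (key p) (w p).+1 +
    \sum_(r < n) ((key r == key p) && (u r == w p)).
  rewrite /cnt -!big_split; apply: eq_bigr => r _ /=; rewrite -val_eqE /=; lia.
have := splitE w; rewrite -!eq_cnt splitE => /addnI.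
have [/existsP[p' /andP[/eqP e1 /eqP e2]]|/existsPn no] :=
  boolP [exists p', (key p' == key p) && (z p' == w p)]; first by exists p'.
rewrite big1 => [|r _]; last by rewrite (negPf (no r)).
by rewrite (bigD1 p) //= !eqxx.
Qed.

(** The decreasing weights 3(n - p) alone single out [w]. Raising j by 3(j - i) makes it tie with i;
    to stay monotone on the inversions of [w], every other position before j with a larger value
    than w(j), except i, is raised as well. The extra 1 puts these into another class modulo 3, so
    that i and j are the only tie. *)
Definition edge_key w i j p : nat :=
  3 * (n - p) +
  (if [&& p <= j, w j <= w p & p != i] then 3 * (j - i) + (p != j) else 0).

Lemma edge_key_tie w i j : i < j -> edge_key w i j i = edge_key w i j j.
Proof.
move=> ij; have val_neq p p' : (p != p') = (p != p' :> nat) by [].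
by rewrite /edge_key !val_neq; have := ltn_ord j; do 2!case: ifP; lia.
Qed.

Lemma edge_keyP w i j z : i < j -> (ell (w \co tperm i j)).+1 = ell w ->
  ble z w ->
  \sum_p edge_key w i j p * z p <= \sum_p edge_key w i j p * w p /\
  (\sum_p edge_key w i j p * z p = \sum_p edge_key w i j p * w p ->
   z = w \/ z = w \co tperm i j).
Proof.
move=> ij cov zw; have [wij noP] := (ell_tperm_coverP w ij).1 cov.
have val_neq p p' : (p != p') = (p != p' :> nat) by [].
have key_ij := edge_key_tie w ij.
have inj p p' : edge_key w i j p = edge_key w i j p' ->
    p = p' \/ (p = i /\ p' = j) \/ (p = j /\ p' = i).
  rewrite /edge_key !val_neq => E.
  suff : p = p' :> nat \/ (p = i :> nat /\ p' = j :> nat) \/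
      (p = j :> nat /\ p' = i :> nat).
    by case=> [/val_inj|[[/val_inj + /val_inj]|[/val_inj + /val_inj]]]; auto.
  have := ltn_ord p; have := ltn_ord p'; have := ltn_ord j; move: E.
  by do 2!case: ifP; lia.
(* If p' is raised, so is every earlier p with a larger value, except p = i. For p = i the cover
   condition leaves p' = j only, where the keys are equal. *)
have mono p p' : p < p' -> w p' < w p -> edge_key w i j p' <= edge_key w i j p.
  move=> pp' wpp'; have [pi|pi] := eqVneq p i.
    rewrite pi key_ij in pp' wpp' *.
    have [->//|p'j] := eqVneq p' j.
    have := noP p' pp'; rewrite /edge_key !val_neq.
    by have := ltn_ord p'; have := ltn_ord j; move: p'j; rewrite val_neq;
      do 2!case: ifP; lia.
  rewrite /edge_key; move: pi; rewrite !val_neq.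
  by have := ltn_ord p'; have := ltn_ord j; do 2!case: ifP; lia.
have [le_sum eq_sum] := key_max mono zw; split=> // /eq_sum {}eq_sum.
have z_eq p : p <> i -> p <> j -> z p = w p.
  by move=> pi pj; have [p' [/inj[->|[[]|[]]]]] := eq_sum p.
have [p' [/inj cases zp']] := eq_sum i.
have {cases} [ei|ej] : p' = i \/ p' = j by case: cases => [|[[]|[]]]; auto.
  left; apply/permP => p; have [->|/eqP pi] := eqVneq p i; first by rewrite -zp' ei.
  have [->|/eqP pj] := eqVneq p j; last exact: z_eq.
  have [p2 [/inj cases zp2]] := eq_sum j.
  have {cases} [e2|e2] : p2 = i \/ p2 = j by case: cases => [|[[]|[]]]; auto.
    by move: wij; rewrite -zp2 -zp' ei e2 ltnn.
  by rewrite -zp2 e2.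
right; apply/permP => p; rewrite pcompE.
have [->|pi] := eqVneq p i; last first.
  have [->|pj] := eqVneq p j; first by rewrite tpermR -zp' ej.
  by rewrite tpermD 1?eq_sym //; apply: z_eq; apply/eqP.
rewrite tpermL; have [p2 [/inj cases zp2]] := eq_sum j.
have {cases} [e2|e2] : p2 = i \/ p2 = j by case: cases => [|[[]|[]]]; auto.
  by rewrite -zp2 e2.
by move: wij; rewrite -zp2 -zp' ej e2 ltnn.
Qed.

Lemma pos_keyP w z : ble z w ->
  \sum_(p < n) (n - p) * z p <= \sum_(p < n) (n - p) * w p /\
  (\sum_(p < n) (n - p) * z p = \sum_(p < n) (n - p) * w p -> z = w).
Proof.
move=> zw; have [|le_sum eq_sum] := @key_max (fun p : 'I_n => n - p) z w _ zw.
  by move=> p p' pp' _; rewrite leq_sub2l // ltnW.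
split=> // /eq_sum {}eq_sum; apply/permP => p; have [p' [e <-]] := eq_sum p.
congr (z _); apply: val_inj; have := ltn_ord p; have := ltn_ord p'.
by move: e => /= e; lia.
Qed.

End Keys.

(** * Convex hulls, and the edges of the polytope at w *)

Section Hull.
Local Open Scope ring_scope.
Local Open Scope classical_set_scope.
Variable R : realType.

Section Generic.
Variables (n : nat) (I : finType) (A : {set I}) (pt : I -> 'rV[R]_n).

Lemma hull_point i : i \in A -> conv_hull A pt (pt i).
Proof.
move=> iA; exists (fun j => (j == i)%:R); split=> [j _||].
- by rewrite ler0n.
- rewrite (bigD1 i) //= eqxx big1 ?addr0 // => j /andP[_ ji].
  by rewrite (negPf ji).
rewrite (bigD1 i) //= eqxx scale1r big1 ?addr0 // => j /andP[_ ji].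
by rewrite (negPf ji) scale0r.
Qed.

Lemma affine_hull f (c : I -> R) : affine f -> \sum_(i in A) c i = 1 ->
  f (\sum_(i in A) c i *: pt i) = \sum_(i in A) c i * f (pt i).
Proof.
move=> [a [b fE]] c1; rewrite fE dot_sumr -[b]mul1r -c1 mulr_suml -big_split.
by apply: eq_bigr => i _ /=; rewrite fE dotZr mulrDr.
Qed.

Lemma affine_hull_ge0 f : affine f -> (forall i, i \in A -> 0 <= f (pt i)) ->
  forall x, conv_hull A pt x -> 0 <= f x.
Proof.
move=> aff_f f_ge0 x [c [c_ge0 c1 ->]]; rewrite affine_hull //.
by apply: sumr_ge0 => i iA; rewrite mulr_ge0 ?f_ge0 ?c_ge0.
Qed.

Lemma affine_hull_eq0 f : affine f -> (forall i, i \in A -> f (pt i) = 0) ->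
  forall x, conv_hull A pt x -> f x = 0.
Proof.
move=> aff_f f0 x [c [c_ge0 c1 ->]]; rewrite affine_hull // big1 // => i iA.
by rewrite f0 ?mulr0.
Qed.

(** If f vanishes at a convex combination, all the weight lies on points where f vanishes. The
    degenerate case i = j serves to show that w itself is a vertex. *)
Lemma segment_face f i j : i \in A -> j \in A -> affine f ->
  (forall l, l \in A -> 0 <= f (pt l)) ->
  (forall l, l \in A -> f (pt l) = 0 <-> l = i \/ l = j) ->
  segment (pt i) (pt j) = [set x | conv_hull A pt x /\ f x = 0] /\
  is_face (conv_hull A pt) (segment (pt i) (pt j)).
Proof.
move=> iA jA aff_f f_ge0 f0.
suff eq_seg : segment (pt i) (pt j) = [set x | conv_hull A pt x /\ f x = 0].
  by split=> //; rewrite eq_seg; apply: zero_set_face => //; apply: affine_hull_ge0.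
rewrite predeqE => x; split=> [[t [/andP[t0 t1] ->]]|].
  have fi : f (pt i) = 0 by apply/f0; auto.
  have fj : f (pt j) = 0 by apply/f0; auto.
  split; last first.
    have [a [b fE]] := aff_f; rewrite !fE in fi fj *.
    rewrite dotDr dotZr dotDr -scaleN1r dotZr.
    have -> : dot a (pt j) = dot a (pt i) by lra.
    by rewrite mulN1r subrr mulr0 addr0.
  exists (fun l => (1 - t) * (l == i)%:R + t * (l == j)%:R); split.
  - by move=> l _; rewrite addr_ge0 ?mulr_ge0 ?ler0n ?subr_ge0.
  - rewrite big_split /= -!mulr_sumr.
    have S l : l \in A -> \sum_(m in A) (m == l)%:R = 1 :> R.
      move=> lA; rewrite (bigD1 l) //= eqxx big1 ?addr0 // => m /andP[_ ml].
      by rewrite (negPf ml).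
    by rewrite !S // !mulr1 subrK.
  under eq_bigr => l _ do rewrite scalerDl -!scalerA.
  rewrite big_split /= -!scaler_sumr.
  have S l : l \in A -> \sum_(m in A) (m == l)%:R *: pt m = pt l.
    move=> lA; rewrite (bigD1 l) //= eqxx scale1r big1 ?addr0 // => m /andP[_ ml].
    by rewrite (negPf ml) scale0r.
  by rewrite !S // scalerBl scale1r scalerBr addrAC addrA.
move=> [[c [c_ge0 c1 def_x]] fx0].
have cf0 : forall l, l \in A -> c l * f (pt l) = 0.
  apply: psumr_eq0P => [m mA|]; first by rewrite mulr_ge0 ?c_ge0 ?f_ge0.
  by rewrite -affine_hull // -def_x.
have c0 l : l \in A -> l != i -> l != j -> c l = 0.
  move=> lA /eqP li /eqP lj; have /eqP := cf0 l lA.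
  by rewrite mulf_eq0 => /orP[/eqP //|/eqP/(f0 l lA)[]].
have [ij|ij] := eqVneq i j.
  subst j.
  have ci : c i = 1.
    by rewrite -c1 (bigD1 i) //= big1 ?addr0 // => m /andP[mA mi]; apply: c0.
  exists 0; rewrite lexx ler01 scale0r addr0 def_x; split=> //.
  rewrite (bigD1 i) //= ci scale1r big1 ?addr0 // => m /andP[mA mi].
  by rewrite c0 ?scale0r.
have ji : j != i by rewrite eq_sym.
have cij : c i + c j = 1.
  rewrite -c1 (bigD1 i) //= (bigD1 j) ?jA //= big1 ?addr0 //.
  by move=> m /andP[/andP[mA mi] mj]; apply: c0.
exists (c j); have := c_ge0 i iA; have := c_ge0 j jA => cj ci.
split; first by apply/andP; split=> //; lra.
rewrite def_x (bigD1 i) //= (bigD1 j) ?jA //= big1 ?addr0.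
  have -> : c i = 1 - c j by lra.
  by rewrite scalerBl scale1r scalerBr addrAC addrA.
by move=> m /andP[/andP[mA mi] mj]; rewrite c0 ?scale0r.
Qed.

End Generic.

Section Bip.
Variables (n : nat) (v w : 'S_n).
Hypothesis vw : bruhat_le v w.
Local Notation Q := (bruhat_interval_polytope R v w).

Let wA : w \in bruhat_interval v w.
Proof. by rewrite inE vw /=; exact: connect0. Qed.

Let ble_w z : z \in bruhat_interval v w -> ble z w.
Proof. by rewrite inE => /andP[_ /bruhat_leP]. Qed.

Definition key_fun (key : 'I_n -> nat) (x : 'rV[R]_n) : R :=
  \sum_p (key p)%:R * ((w p).+1%:R - x 0 p).

Lemma affine_key key : affine (key_fun key).
Proof.
exists (- \row_p (key p)%:R), (\sum_p (key p)%:R * (w p).+1%:R) => x.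
rewrite /key_fun /dot -big_split /=; apply: eq_bigr => p _.
by rewrite !mxE mulrBr mulNr.
Qed.

Lemma key_fun_perm key z : key_fun key (perm_point R z) =
  (\sum_p key p * w p)%N%:R - (\sum_p key p * z p)%N%:R.
Proof.
rewrite !natr_sum -sumrB; apply: eq_bigr => p _; rewrite mxE !natrM.
by rewrite -!natr1; ring.
Qed.

Lemma perm_point_inj : injective (@perm_point R n).
Proof.
move=> u z /matrixP uz; apply/permP => p; apply: val_inj.
by have /eqP := uz 0 p; rewrite !mxE eqr_nat => /eqP[].
Qed.

Lemma key_fun_face key (z : 'S_n) : z \in bruhat_interval v w ->
  (\sum_p key p * z p = \sum_p key p * w p)%N ->
  (forall u, ble u w -> (\sum_p key p * u p <= \sum_p key p * w p)%N /\
     ((\sum_p key p * u p = \sum_p key p * w p)%N -> u = w \/ u = z)) ->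
  let S := segment (perm_point R w) (perm_point R z) in
  is_face Q S /\ forall u, u \in bruhat_interval v w -> S (perm_point R u) ->
  u = w \/ u = z.
Proof.
move=> zA eq_z key_max.
have [] := @segment_face n _ (bruhat_interval v w) (@perm_point R n)
  (key_fun key) w z wA zA (affine_key key).
- by move=> u /ble_w/key_max[le_u _]; rewrite key_fun_perm subr_ge0 ler_nat.
- move=> u /ble_w/key_max[_ eq_u]; rewrite key_fun_perm; split.
    by move/eqP; rewrite subr_eq0 eqr_nat eq_sym => /eqP/eq_u.
  by case=> ->; rewrite ?eq_z subrr.
move=> eq_seg face; split=> // u uA; rewrite eq_seg => -[_ /eqP].
rewrite key_fun_perm subr_eq0 eqr_nat eq_sym => /eqP.
by case: (key_max u (ble_w uA)) => _; apply.
Qed.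

Lemma coatom_edges_not_cube (i j : 'I_n -> 'I_n) : (0 < n)%N ->
  (forall e, (i e < j e)%N /\ (ell (w \co tperm (i e) (j e))).+1 = ell w) ->
  (forall e, bruhat_le v (w \co tperm (i e) (j e))) ->
  (forall e e', i e = i e' -> j e = j e' -> e = e') ->
  ~ comb_cube Q.
Proof.
move=> n_gt0 cov le_v inj_e [d equiv].
pose z e := w \co tperm (i e) (j e).
have zA e : z e \in bruhat_interval v w.
  have [ij cov_e] := cov e.
  by rewrite inE le_v; have /andP[/andP[_]] := bruhat_covers_tperm ij cov_e.
have zE e p : z e p = w (tperm (i e) (j e) p) by rewrite pcompE.
have neq_ij e : i e != j e by rewrite -val_eqE neq_ltn (cov e).1.
have neq_z e : perm_point R (z e) <> perm_point R w.
  move/perm_point_inj => zw; have := zE e (i e); rewrite zw tpermL.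
  by move/perm_inj/eqP; rewrite (negPf (neq_ij e)).
have sum_edge e :
    (\sum_p edge_key w (i e) (j e) p * z e p = \sum_p edge_key w (i e) (j e) p * w p)%N.
  have [ij cov_e] := cov e.
  rewrite (reindex_inj (@perm_inj _ (tperm (i e) (j e)))) /=.
  apply: eq_bigr => p _; rewrite zE tpermK; congr (_ * _)%N.
  by case: tpermP => [->|->|] //; rewrite edge_key_tie.
have faces_z e := key_fun_face (zA e) (sum_edge e)
  (fun u => @edge_keyP n w (i e) (j e) u (cov e).1 (cov e).2).
have face_w : is_face Q [set perm_point R w].
  have seg_ww : segment (perm_point R w) (perm_point R w) = [set perm_point R w].
    rewrite predeqE => x /=; split=> [[t [_ ->]]|->].
      by rewrite subrr scaler0 addr0.
    by exists 0; rewrite lexx ler01 scale0r addr0.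
  have [|+ _] := @key_fun_face (fun p => n - p)%N w wA erefl _.
    by move=> u uw; have [] := pos_keyP uw; split; auto.
  by rewrite seg_ww.
have notin_z e e' : e <> e' ->
    ~ segment (perm_point R w) (perm_point R (z e)) (perm_point R (z e')).
  move=> ne /((faces_z e).2 _ (zA e')) [zw|zz].
    by apply: (neq_z e'); rewrite zw.
  have [ij _] := cov e; have [ij' _] := cov e'; apply: ne.
  have t_eq p : tperm (i e) (j e) p = tperm (i e') (j e') p.
    by apply: (@perm_inj _ w); rewrite -!zE zz.
  have := t_eq (i e); rewrite tpermL; case: tpermP => [ei ej|ei ej|_ _ ej].
  - by apply: inj_e.
  - by move: ij ij'; rewrite ej ei; lia.
  - by have := neq_ij e; rewrite ej eqxx.
have free := edges_row_free (@cube_cube_data R d) equiv face_w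
  (fun e => (faces_z e).1) neq_z notin_z.
have := @sum0_not_row_free R n (\matrix_(e < n)
  (perm_point R (z e) - perm_point R w)) n_gt0.
move=> /(_ _)/negP; apply; last exact: free.
move=> e; under eq_bigr => p _ do rewrite !mxE.
rewrite sumrB; apply/eqP; rewrite subr_eq0; apply/eqP.
rewrite (reindex_inj (@perm_inj _ (tperm (i e) (j e)))) /=.
by apply: eq_bigr => p _; rewrite zE tpermK.
Qed.

End Bip.
End Hull.

(** * The polytope of the interval *)

Section TwoCrossings.
Variables (R : realType) (n k : nat) (v w : 'S_n).
Hypothesis vw : rotated v w k.
Local Notation coatom_pair := (coatom_pair k w).

Lemma two_cross_not_cube i j i' j' : i < k -> k <= j -> coatom_pair i j ->
  i' < k -> k <= j' -> coatom_pair i' j' -> (i, j) <> (i', j') ->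
  ~ comb_cube (bruhat_interval_polytope R v w).
Proof.
have [k1 kn] := rot_k vw => ik kj gij ik' kj' gij' neq.
(* Slots 0 < m < k hold the pairs (1) ending at m, slots m > k the pairs (2) starting at m - 1. The
   two slots left over, 0 and k, take the two pairs (3). *)
have edge (m : 'I_n) : exists e : 'I_n * 'I_n, coatom_pair e.1 e.2 /\
    [/\ m = 0 :> nat -> e.1 = i :> nat /\ e.2 = j :> nat,
        0 < m < k -> e.2 = m :> nat,
        m = k :> nat -> e.1 = i' :> nat /\ e.2 = j' :> nat &
        k < m -> k <= e.1 /\ e.1 = m.-1 :> nat].
  have mk e1 e2 : coatom_pair e1 e2 -> exists e : 'I_n * 'I_n,
      e.1 = e1 :> nat /\ e.2 = e2 :> nat.
    by case=> lt1 lt2 _ _; exists (Ordinal (ltn_trans lt1 lt2), Ordinal lt2).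
  have lt_m := ltn_ord m.
  have [m0|m0] := posnP m.
    have [e [E1 E2]] := mk _ _ gij; exists e; rewrite !E1 !E2.
    by split=> //; split=> //; lia.
  have [mk'|km|mk'] := ltngtP m k.
  - have m_k : 0 < m < k by rewrite m0.
    have [l [lm wl near]] := left_edge vw m_k.
    have gd : coatom_pair l m by split=> // p lp; split; [by have := near p; lia | lia].
    have [e [E1 E2]] := mk _ _ gd; exists e; rewrite !E1 !E2.
    by split=> //; split=> //; lia.
  - have m_k : k <= m.-1 < n.-1 by lia.
    have [l [ml ln wl near]] := right_edge vw m_k.
    have gd : coatom_pair m.-1 l by split=> // p lp; split; [lia | by have := near p; lia].
    have [e [E1 E2]] := mk _ _ gd; exists e; rewrite !E1 !E2.
    by split=> //; split=> //; lia.
  have [e [E1 E2]] := mk _ _ gij'; exists e; rewrite !E1 !E2.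
  by split=> //; split=> //; lia.
have {edge} [f fP] := choice edge.
apply: (@coatom_edges_not_cube R n v w _ (fun m => (f m).1) (fun m => (f m).2)).
- by apply/bruhat_leP; exact: rot_ble vw.
- by lia.
- by move=> m; have [gd _] := fP m; split; [case: gd | exact: (coatom_pair_cover gd)].
- by move=> m; have [gd _] := fP m; exact: (coatom_pair_le vw).
move=> m m' e1 e2; have [g [s0 s1 s2 s3]] := fP m; have [g' [s0' s1' s2' s3']] := fP m'.
rewrite -e1 -e2 in g' s0' s1' s2' s3'; case: g => lt_e _ _ _.
have eqb m1 : m1 < k -> 0 < m1 -> 0 < m1 < k by move=> -> ->.
apply: val_inj => /=; have := ltn_ord m; have := ltn_ord m'.
have [m0|m0] := posnP m; have [m0'|m0'] := posnP m'; try lia.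
- have [a1 a2] := s0 m0; have [mk|mk|mk] := ltngtP m' k.
  + by have := s1' (eqb _ mk m0') => E; rewrite E in a2; lia.
  + by have := s3' mk; lia.
  by have [b1 b2] := s2' mk; case: neq; rewrite -a1 -a2 -b1 -b2.
- have [a1 a2] := s0' m0'; have [mk|mk|mk] := ltngtP m k.
  + by have := s1 (eqb _ mk m0) => E; rewrite E in a2; lia.
  + by have := s3 mk; lia.
  by have [b1 b2] := s2 mk; case: neq; rewrite -a1 -a2 -b1 -b2.
Qed.

End TwoCrossings.

Section CubeCase.
Local Open Scope ring_scope.
Variables (R : realType) (n k : nat) (v w : 'S_n).
Hypothesis vw : rotated v w k.
Local Notation Q := (bruhat_interval_polytope R v w).

Definition sum_rk (z : 'S_n) t : nat := (\sum_(x < n) rk z t x)%N.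

(** An entry is counted at the thresholds from 0 up to itself, one more than its 0-based value: the
    threshold 0 accounts for the shift in [perm_point]. *)
Lemma psum_perm_point (z : 'S_n) t : (t <= n)%N ->
  psum t (perm_point R z) = (sum_rk z t)%:R.
Proof.
move=> tn; rewrite /sum_rk (eq_bigr _ (fun (x : 'I_n) _ => rk_ord z x tn)).
rewrite exchange_big /= natr_sum /psum big_mkcond; apply: eq_bigr => i _.
case: ifP => it; last by rewrite big1.
by rewrite mxE (eq_bigr (fun x : 'I_n => (x < (z i).+1)%N : nat)) ?sum_leq_ord.
Qed.

Lemma between_interval z : z \in bruhat_interval v w <-> between v w z.
Proof.
rewrite inE; split=> [/andP[/bruhat_leP ? /bruhat_leP ?] //|[? ?]].
by apply/andP; split; apply/bruhat_leP.
Qed.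

Section Unique.
Variables p q : nat.
Hypotheses (pk : (p < k)%N) (kq : (k <= q)%N) (qn : (q < n)%N).
Hypotheses (wp : (pv w n.-1 < pv w p)%N) (wq : (pv w q < pv w 0)%N).
Hypothesis (wqp : (pv w q < pv w p)%N).
Hypothesis near_p : forall l, (p < l < k)%N -> (pv w l < pv w n.-1)%N.
Hypothesis near_q : forall l, (k <= l < q)%N -> (pv w 0 < pv w l)%N.

Lemma unique_cross_cube : comb_cube Q.
Proof.
have [k1 kn] := rot_k vw; have n0 : (0 < n)%N by lia.
have idx (m : 'I_n.-1) : (0 < m.+1 < n)%N by have := ltn_ord m; lia.
have ex_facet (m : 'I_n.-1) : exists u : nat * (nat * nat),
    facet_pair k v w p m.+1 u.1 u.2.1 u.2.2.
  have [h [g [g' F]]] := facet_exists vw pk kq qn wp wq wqp near_p near_q (idx m).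
  by exists (h, (g, g')).
have {ex_facet} [u uP] := choice ex_facet.
pose h m := (u m).1; pose g m := (u m).2.1; pose g' m := (u m).2.2.
have h_n m : (h m <= n)%N by case: (facet_h (uP m)).
have g_n m : (g m <= n)%N by case: (facet_g (uP m)).
have g'_n m : (g' m <= n)%N by case: (facet_g' (uP m)).
have m_n (m : 'I_n.-1) : (m.+1 <= n)%N by have := idx m; lia.
pose sw t := psum t (perm_point R w); pose sv t := psum t (perm_point R v).
pose L (m : 'I_n.-1) (x : 'rV[R]_n) := psum (h m) x - psum m.+1 x + (sw m.+1 - sw (h m)).
pose G (m : 'I_n.-1) (x : 'rV[R]_n) := psum m.+1 x - psum (g m) x - psum (g' m) x -
  (sv m.+1 - sv (g m) - sv (g' m)).
have affL (m : 'I_n.-1) : affine (L m).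
  have := affineD (affineD (affine_psum R n (h m))
    (affineZ (-1) (affine_psum R n m.+1))) (affine_cst n (sw m.+1 - sw (h m))).
  by move=> [c [b E]]; exists c, b => x; rewrite -E mulN1r.
have affG (m : 'I_n.-1) : affine (G m).
  have := affineD (affineD (affineD (affine_psum R n m.+1)
    (affineZ (-1) (affine_psum R n (g m))))
    (affineZ (-1) (affine_psum R n (g' m))))
    (affine_cst n (- (sv m.+1 - sv (g m) - sv (g' m)))).
  by move=> [c [b E]]; exists c, b => x; rewrite -E !mulN1r.
have Lz m z : L m (perm_point R z) =
    (sum_rk w m.+1 + sum_rk z (h m))%:R - (sum_rk z m.+1 + sum_rk w (h m))%:R.
  by rewrite /L /sw !psum_perm_point // !natrD; ring.
have Gz m z : G m (perm_point R z) =
    (sum_rk z m.+1 + sum_rk v (g m) + sum_rk v (g' m))%:R -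
    (sum_rk v m.+1 + sum_rk z (g m) + sum_rk z (g' m))%:R.
  by rewrite /G /sv !psum_perm_point // !natrD; ring.
have L_ge0 m z : between v w z -> 0 <= L m (perm_point R z).
  move=> bz; rewrite Lz subr_ge0 ler_nat /sum_rk -!big_split leq_sum // => x _.
  exact: (facet_upper (uP m)).
have G_ge0 m z : between v w z -> 0 <= G m (perm_point R z).
  move=> bz; rewrite Gz subr_ge0 ler_nat /sum_rk -!big_split leq_sum // => x _.
  exact: (facet_lower (uP m)).
(* The threshold carrying the strict inequality must be one of the summation indices. The index m of
   'I_n.-1 stands for the prefix of length m + 1. *)
have thr_n (m : 'I_n.-1) : (thr k w p m.+1 < n)%N.
  have /andP[_ le_hi] := thr_gap vw pk kq qn wp wq wqp (idx m).
  apply: leq_ltn_trans le_hi _; rewrite /hi; case: ifP => _; apply: pv_lt => //.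
  exact: m_n.
have L_eq0 (m : 'I_n.-1) (z : 'S_n) : between v w z ->
    rk z m.+1 (thr k w p m.+1) = rk w m.+1 (thr k w p m.+1) ->
    L m (perm_point R z) = 0 /\ 0 < G m (perm_point R z).
  move=> bz bit1; split.
    apply/eqP; rewrite Lz subr_eq0 eqr_nat /sum_rk -!big_split; apply/eqP.
    by apply: eq_bigr => x _; rewrite /= (facet_upper_eq (uP m)).
  rewrite Gz subr_gt0 ltr_nat /sum_rk -!big_split /=.
  rewrite (bigD1 (Ordinal (thr_n m))) //= [X in (_ < X)%N](bigD1 (Ordinal (thr_n m))) //=.
  rewrite -addSn leq_add //; first exact: (facet_lower_lt (uP m)).
  by rewrite leq_sum // => x _; apply: (facet_lower (uP m)).
have G_eq0 (m : 'I_n.-1) (z : 'S_n) : between v w z ->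
    (rk z m.+1 (thr k w p m.+1) < rk w m.+1 (thr k w p m.+1))%N ->
    G m (perm_point R z) = 0 /\ 0 < L m (perm_point R z).
  move=> bz bit0; split.
    apply/eqP; rewrite Gz subr_eq0 eqr_nat /sum_rk -!big_split; apply/eqP.
    by apply: eq_bigr => x _; rewrite /= (facet_lower_eq (uP m)).
  rewrite Lz subr_gt0 ltr_nat /sum_rk -!big_split /=.
  rewrite (bigD1 (Ordinal (thr_n m))) //= [X in (_ < X)%N](bigD1 (Ordinal (thr_n m))) //=.
  rewrite -addSn leq_add //; first exact: (facet_upper_lt (uP m)).
  by rewrite leq_sum // => x _; apply: (facet_upper (uP m)).
suff data : cube_data Q L G.
  by exists n.-1; apply: cube_data_equiv data (@cube_cube_data R n.-1).
have sum_point (z : 'S_n) : psum n (perm_point R z) = \sum_(j < n) j.+1%:R.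
  rewrite /psum (eq_bigl xpredT) => [|i]; last exact: ltn_ord.
  rewrite (reindex_inj (@perm_inj _ z^-1%g)) /=.
  by apply: eq_bigr => i _; rewrite mxE permKV.
have total x : Q x -> psum n x = sw n.
  have aff : affine (fun x : 'rV[R]_n => psum n x + - sw n).
    have [c [b E]] := affineD (affine_psum R n n) (affine_cst n (- sw n)).
    by exists c, b => y; rewrite -E.
  move=> Qx; apply/eqP; rewrite -subr_eq0; apply/eqP; move: x Qx.
  by apply: (affine_hull_eq0 aff) => z _; rewrite /sw !sum_point subrr.
split.
- by move=> m; split.
- move=> x m Qx; split; [move: x Qx | move: x Qx];
    (apply: affine_hull_ge0; [exact: affL || exact: affG |]) => z /between_interval.
    exact: L_ge0.
  exact: G_ge0.
(* L m vanishes at a vertex when the bit of w is kept, so the bits to be cleared are those outside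
   A. *)
- move=> A; pose B := [set m : 'I_n |
    [exists i : 'I_n.-1, (i.+1 == m :> nat) && (i \notin A)]]%SET.
  have [|z [bz bitz]] := all_bits vw pk kq qn wp wq wqp near_p near_q (B := B).
    by move=> m; rewrite inE => /existsP[i /andP[/eqP <-]].
  exists (perm_point R z); split.
    by apply: hull_point; apply/between_interval.
  move=> m; have lt_m : (m.+1 < n)%N by have := idx m; lia.
  have := bitz (Ordinal lt_m) isT; rewrite inE /=.
  have -> : [exists i : 'I_n.-1, (i.+1 == m.+1 :> nat) && (i \notin A)] = (m \notin A).
    apply/existsP/idP => [[i /andP[/eqP[/val_inj ->]]] //|mA].
    by exists m; rewrite eqxx.
  case: (m \in A) => /= bitE.
    have [|-> G0] := L_eq0 m z bz; first by rewrite -bitE addn0.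
    by rewrite eqxx gt_eqF.
  have [|-> L0] := G_eq0 m z bz; first by rewrite -bitE addn1.
  by rewrite eqxx gt_eqF.
move=> c; have [e [e0 cE]] := dot_psum c n0.
(* The coefficient of X_(i+1) in X_t; for t = 0 or t = n it is zero, and [psum_index] puts X_t into
   the constant term. *)
pose ind t (i : 'I_n.-1) : R := (i.+1 == t :> nat)%:R.
have ind_ord m t : earlier k w m t -> forall i : 'I_n.-1, ind t i != 0 ->
    (ord k w i.+1 < ord k w m)%N.
  move=> [_ et] i; rewrite /ind pnatr_eq0 eqb0 negbK => /eqP it.
  by case: et => [t0|tn|[_]]; [lia | have := ltn_ord i; lia | rewrite it].
have a_ord (m i : 'I_n.-1) : ind (h m) i != 0 -> (ord k w i.+1 < ord k w m.+1)%N.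
  by apply: ind_ord; exact: (facet_h (uP m)).
have b_ord (m i : 'I_n.-1) : ind (g m) i + ind (g' m) i != 0 ->
    (ord k w i.+1 < ord k w m.+1)%N.
  have := ind_ord _ _ (facet_g (uP m)) i.
  have := ind_ord _ _ (facet_g' (uP m)) i; rewrite -/(g m) -/(g' m).
  have [->|_ _ /(_ isT) //] := eqVneq (ind (g m) i) 0.
  by rewrite add0r.
have LE (m : 'I_n.-1) x : Q x -> L m x =
    ((h m == n)%:R * sw n + (sw m.+1 - sw (h m))) +
    \sum_(i < n.-1) ind (h m) i * psum i.+1 x - psum m.+1 x.
  by move=> /total xN; rewrite /L (psum_index n0 (h_n m) xN) /ind; ring.
have GE (m : 'I_n.-1) x : Q x -> G m x =
    - ((g m == n)%:R * sw n + (g' m == n)%:R * sw n +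
       (sv m.+1 - sv (g m) - sv (g' m))) -
    \sum_(i < n.-1) (ind (g m) i + ind (g' m) i) * psum i.+1 x + psum m.+1 x.
  move=> /total xN; rewrite /G (psum_index n0 (g_n m) xN).
  rewrite (psum_index n0 (g'_n m) xN).
  under [\sum_(i < n.-1) (_ + _) * _]eq_bigr => i _ do rewrite mulrDl.
  by rewrite big_split /= /ind; ring.
have [K [l [s [pos E]]]] := triangular_decomp a_ord b_ord LE GE e.
exists (e0 * sw n + K), l, s; split=> // x Qx.
by rewrite cE (total x Qx) E // addrA.
Qed.

End Unique.
End CubeCase.

(* Positions and values are shifted by one: the ordinal i stands for i + 1. *)
Theorem proposition8p6 (R : realType) (n k : nat) (v w : 'S_n)
    (hn : 4 <= n) (hk2 : 2 <= k) (hkn : k <= n - 2)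
    (hw : w = v \co comp_prod [seq simple_tr n m | m <- iota k (n - k)]
                \co comp_prod [seq simple_tr n m | m <- rev (iota 1 (k - 1))])
    (hl : ell w = ell v + (n - 1)) :
  let cocover (i j : 'I_n) := i < j /\ (ell (w \co tperm i j)).+1 = ell w in
  let cond1 (i j : 'I_n) := i < j /\ j.+1 <= k /\
        (forall p : 'I_n, i < p -> p < j -> w p < w j) in
  let cond2 (i j : 'I_n) := k < i.+1 /\ i < j /\
        (forall p : 'I_n, i < p -> p < j -> w i < w p) in
  let cond3 (i j : 'I_n) := i.+1 <= k /\ k < j.+1 /\
        (forall p : 'I_n, i < p -> p.+1 <= k -> w p < w j) /\
        (forall p : 'I_n, k < p.+1 -> p < j -> w i < w p) in
  (forall i j : 'I_n, i < j ->
     ((ell (w \co tperm i j)).+1 = ell w <->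
      w j < w i /\
      forall p : 'I_n, i < p -> p < j -> ~ (w j <= w p /\ w p <= w i))) /\
  (forall i j : 'I_n, cocover i j ->
     (coatom v w (w \co tperm i j) <-> cond1 i j \/ cond2 i j \/ cond3 i j)) /\
  (comb_cube (bruhat_interval_polytope R v w) <->
     exists! q : 'I_n * 'I_n, cocover q.1 q.2 /\ cond3 q.1 q.2).
Proof.
move=> cocover cond1 cond2 cond3.
have vw := rotatedP hn hk2 hkn hw hl; have [k1 kn] := rot_k vw.
have cross_cond (i j : 'I_n) :
    cocover i j /\ cond3 i j <-> i < k /\ k <= j /\ coatom_pair k w i j.
  split=> [[[ij cov] [ik [kj [c1 c2]]]]|[ik [kj gd]]].
    have [wij _] := (ell_tperm_coverP w ij).1 cov.
    split=> //; split=> //; split; rewrite ?pvE //.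
    move=> l il; have lt_l : l < n by have := ltn_ord j; lia.
    rewrite -[l]/(nat_of_ord (Ordinal lt_l)) pvE.
    by split=> /= lk; [apply: c1 | apply: c2]; rewrite /=; lia.
  have [ij _ _ near] := gd; split.
    by split=> //; apply: coatom_pair_cover gd.
  split=> //; split=> //; split=> p pi pj; rewrite -!pvE.
    by have := near p; lia.
  by have := near p; lia.
split; first exact: ell_tperm_coverP.
split=> [i j [ij cov]|].
  rewrite (coatomP vw ij cov); split=> [near|].
    have near' p : i < p -> p < j -> (p < k -> pv w p < pv w j) /\
        (k <= p -> pv w i < pv w p) by move=> ip pj; apply: near; rewrite ip.
    have [jk|kj] := ltnP j k.
      left; split=> //; split=> // p ip pj; rewrite -!pvE.
      by have := near' p ip pj; lia.
    right; have [ik|ki] := ltnP i k.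
      right; split=> //; split=> //; split=> p pi pj; rewrite -!pvE.
        by have := near' p pi; lia.
      by have := near' p _ pj; lia.
    left; split=> //; split=> // p ip pj; rewrite -!pvE.
    by have := near' p ip pj; lia.
  move=> cnd p ipj; have lt_p : p < n by have := ltn_ord j; lia.
  rewrite -[p]/(nat_of_ord (Ordinal lt_p)) !pvE; case: cnd => [[_ [jk c]]|[[ki [_ c]]|]].
  - by split=> /= pk; [apply: c | move: pk]; rewrite /=; lia.
  - by split=> /= pk; [move: pk | apply: c]; rewrite /=; lia.
  move=> [ik [kj [c1 c2]]].
  by split=> /= pk; [apply: c1 | apply: c2]; rewrite /=; lia.
split.
  move=> is_cube; have [i [j [ik kj gd]]] := cross_exists vw.
  have [ij jn _ _] := gd.
  exists (Ordinal (ltn_trans ij jn), Ordinal jn); split; first exact/cross_cond.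
  move=> [i' j'] /cross_cond /= [ik' [kj' gd']].
  apply: contrapT => neq; apply: (two_cross_not_cube vw ik kj gd ik' kj' gd' _ is_cube).
  by case=> ei ej; apply: neq; congr (_, _); apply: val_inj.
move=> [[i0 j0] [_ uniq]].
have [] := cross_uniq vw.
  move=> i j i' j' ik kj gd ik' kj' gd'.
  have [ij jn _ _] := gd; have [ij' jn' _ _] := gd'.
  have e : (i0, j0) = (Ordinal (ltn_trans ij jn), Ordinal jn).
    by apply: uniq; apply/cross_cond.
  have : (i0, j0) = (Ordinal (ltn_trans ij' jn'), Ordinal jn').
    by apply: uniq; apply/cross_cond.
  by rewrite e => -[-> ->].
move=> p [q [[pk kq] qn [wp wq] [near_p near_q] wqp]].
exact: (unique_cross_cube R vw pk kq qn wp wq wqp near_p near_q).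
Qed.
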